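(* Let $C\subset\mathbb{R}^2$ be an oval and $p\in\operatorname{int}(C)$. Assume that $C$ and $p$ are generic, so that the relevant zeros (those of $a_p$, $a_p'$ and $q_p$) are simple and $\operatorname{ART}_C(p)$ has only ordinary cusps. Let $M_C(p)$ be the number of chords of $C$ with midpoint $p$, and let $T_C(p)$ be the number of affine chords $\overline{x\,\iota_C(x)}$, $x\in C$, passing through $p$. Then $$\#\operatorname{Cusps}\bigl(\operatorname{ART}_C(p)\bigr)\ \ge\ \max\{3,T_C(p)\}\ \ge\ \max\{3,M_C(p)\}.$$ In particular, if $p$ belongs to a Wigner caustic chamber containing $2r+1$ centred chords (that is, $M_C(p)=2r+1$), then $\operatorname{ART}_C(p)$ has at least $2r+1$ cusps.
   Context: An oval is a smooth ($C^\infty$), strictly convex simple closed curve $C\subset\mathbb{R}^2$ with positive curvature; $\operatorname{int}(C)$ is the open region it bounds. For $x\in C$, $\iota_C(x)\in C$ is the unique point different from $x$ whose tangent line is parallel to $T_xC$. An affine chord is a line $\overline{x\,\iota_C(x)}$. $\Phi_C$ sends a line $\overline{xy}$ ($x\ne y\in C$) to $\overline{\iota_C(x)\iota_C(y)}$; $\Lambda_p$ is the pencil of lines through $p$; $\operatorname{ART}_C(p)$ is the envelope of the line family $\Phi_C(\Lambda_p)$. Put $n(\theta)=(\cos\theta,\sin\theta)$, $\tau(\theta)=(-\sin\theta,\cos\theta)$. The normal direction is a global parameter of this family: for each $\theta$ there is exactly one line of $\Phi_C(\Lambda_p)$ with normal $n(\theta)$, written $n(\theta)\cdot(x-p)=q_p(\theta)$,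 where $q_p$ is smooth and $q_p(\theta+\pi)=-q_p(\theta)$. Then $\operatorname{ART}_C(p)$ is the closed front $X(\theta)=p+q_p(\theta)n(\theta)+q_p'(\theta)\tau(\theta)$, $\theta\in[0,\pi]$; its singular parameters are the zeros of $\rho_p=q_p+q_p''$, and a zero gives an ordinary (semicubical) cusp when it is simple. Cusps are counted by parameters in $[0,\pi)$. Write $C$ in polar coordinates about $p$ as $p+r_p(\varphi)n(\varphi)$ with $r_p>0$, and put $a_p(\varphi)=\log\frac{r_p(\varphi+\pi)}{r_p(\varphi)}$. The zeros of $a_p$ modulo $\pi$ are the chords of midpoint $p$ and the zeros of $a_p'$ modulo $\pi$ are the affine chords through $p$; the zeros of $q_p$ modulo $\pi$ also correspond to the affine chords through $p$. The Wigner caustic is $\mathrm E_{0.5}(C)=\{\tfrac12(x+\iota_C(x)):x\in C\}$; its chambers are the connected components of its complement, and $M_C$ is constant on them for generic basepoints. *)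

(* Defs.v *)
From mathcomp Require Import all_boot all_order all_algebra.
From mathcomp Require Import all_classical all_reals all_analysis.

Set Implicit Arguments.
Unset Strict Implicit.
Unset Printing Implicit Defensive.

Import Order.TTheory GRing.Theory Num.Theory.
Import numFieldNormedType.Exports.

Local Open Scope classical_set_scope.
Local Open Scope ring_scope.

Section plane.
Context {R : realType}.
Implicit Types (x y p : R * R) (L : set (R * R)).

Definition dot x y : R := x.1 * y.1 + x.2 * y.2.

Definition cross x y : R := x.1 * y.2 - x.2 * y.1.

Definition midpoint x y : R * R := 2^-1 *: (x + y).

Definition nvec (theta : R) : R * R := (cos theta, sin theta).

Definition tvec (theta : R) : R * R := (- sin theta, cos theta).

(* A line only when [x <> y]. *)
Definition line_through x y : set (R * R) :=
  [set z | cross (y - x) (z - x) = 0].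

Definition line_normal p (theta c : R) : set (R * R) :=
  [set z | dot (nvec theta) (z - p) = c].

Definition pencil p : set (set (R * R)) :=
  [set L | (exists x y, x <> y /\ L = line_through x y) /\ L p].

Definition velocity (g : R -> R * R) (t : R) : R * R :=
  (derive1 (fst \o g) t, derive1 (snd \o g) t).

Definition acceleration (g : R -> R * R) : R -> R * R :=
  velocity (velocity g).

Definition smooth (f : R -> R) :=
  forall (n : nat) (t : R), derivable (derive1n n f) t 1.

Definition curvature (g : R -> R * R) (t : R) : R :=
  cross (velocity g t) (acceleration g t)
  / Num.sqrt (dot (velocity g t) (velocity g t)) ^+ 3.

Definition simple_zero (f : R -> R) (t : R) := f t = 0 /\ derive1 f t <> 0.

Definition simple_zeros (f : R -> R) := forall t, f t = 0 -> simple_zero f t.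

End plane.

(* An oval, given by a regular periodic parametrization of the curve. The
   parametrization is taken counterclockwise, which is no restriction on the
   underlying point set: the signed curvature is then positive and strict
   convexity says that, away from the point of tangency, the curve lies strictly
   to the left of each of its tangent lines. *)
Record oval (R : realType) := Oval {
  param :> R -> R * R;
  period : R;
  period_gt0 : 0 < period;
  param_periodic : forall t, param (t + period) = param t;
  param_simple : forall s t, 0 <= s < period -> 0 <= t < period ->
    param s = param t -> s = t;
  param_smooth : smooth (fst \o param) /\ smooth (snd \o param);
  param_regular : forall t, velocity param t <> 0;
  strictly_convex : forall s t, param s <> param t ->
    0 < cross (velocity param t) (param s - param t);
  curvature_gt0 : forall t, 0 < curvature param t }.

Section oval_theory.
Context {R : realType} (C : oval R).
Implicit Types (x y p : R * R) (L U : set (R * R)).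

Definition oval_curve : set (R * R) := range C.

(* The bounded component of the complement of the curve. *)
Definition oval_int : set (R * R) :=
  [set p | ~ oval_curve p /\
           bounded_set (connected_component (~` oval_curve) p)].

Definition parallel_tangents x y :=
  exists s t, [/\ C s = x, C t = y & cross (velocity C s) (velocity C t) = 0].

(* Meaningful for [x] on the curve, where the set below is a singleton. *)
Definition iota_oval x : R * R :=
  xget x [set y | [/\ oval_curve y, y <> x & parallel_tangents x y]].

Definition affine_chord L :=
  exists2 x, oval_curve x & L = line_through x (iota_oval x).

Definition affine_chords_at p : set (set (R * R)) :=
  [set L | affine_chord L /\ L p].

(* A chord is represented by the set of its two endpoints. *)
Definition centred_chords p : set (set (R * R)) :=
  [set c | exists x y, [/\ oval_curve x, oval_curve y, x <> y,
                           c = [set x; y] & midpoint x y = p]].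

(* The graph of the map sending the line xy to the line iota(x)iota(y). *)
Definition Phi L L' :=
  exists x y, [/\ oval_curve x, oval_curve y, x <> y,
                  L = line_through x y &
                  L' = line_through (iota_oval x) (iota_oval y)].

Definition Phi_pencil p : set (set (R * R)) :=
  [set L' | exists2 L, pencil p L & Phi L L'].

(* For [p] inside the oval, exactly one [c] satisfies the condition. *)
Definition ART_support p (theta : R) : R :=
  xget 0 [set c | Phi_pencil p (line_normal p theta c)].

(* The envelope of the lines [line_normal p theta (ART_support p theta)]. *)
Definition ART p (theta : R) : R * R :=
  p + ART_support p theta *: nvec theta
    + derive1 (ART_support p) theta *: tvec theta.

Definition ART_rho p (theta : R) : R :=
  ART_support p theta + derive1n 2 (ART_support p) theta.

(* The velocity of [ART p] is [ART_rho p theta *: tvec theta]: singular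
   parameters are the zeros of [ART_rho p], and simple zeros give the ordinary
   (semicubical) cusps. *)
Definition ART_ordinary_cusp p (theta : R) := simple_zero (ART_rho p) theta.

Definition ART_only_ordinary_cusps p :=
  forall theta, velocity (ART p) theta = 0 -> ART_ordinary_cusp p theta.

Definition ART_cusps p : set R :=
  [set theta | 0 <= theta < pi /\ ART_ordinary_cusp p theta].

(* For [p] inside the oval, exactly one [r] satisfies the condition. *)
Definition polar_radius p (phi : R) : R :=
  xget 0 [set r | 0 < r /\ oval_curve (p + r *: nvec phi)].

Definition log_ratio p (phi : R) : R :=
  ln (polar_radius p (phi + pi) / polar_radius p phi).

Definition generic_basepoint p :=
  [/\ simple_zeros (log_ratio p),
      simple_zeros (derive1 (log_ratio p)),
      simple_zeros (ART_support p) &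
      ART_only_ordinary_cusps p].

Definition wigner_caustic : set (R * R) :=
  [set midpoint x (iota_oval x) | x in oval_curve].

Definition wigner_chamber U :=
  exists2 z, ~ wigner_caustic z &
    U = connected_component (~` wigner_caustic) z.

End oval_theory.

(* Main.v *)
Require Import Defs.
From mathcomp Require Import all_boot all_order all_algebra.
From mathcomp Require Import ring lra zify.
From mathcomp Require Import all_classical all_reals all_analysis.
Set Implicit Arguments.
Unset Strict Implicit.
Unset Printing Implicit Defensive.

Import Order.TTheory GRing.Theory Num.Theory.
Import numFieldNormedType.Exports.
Local Open Scope card_scope.
Local Open Scope classical_set_scope.
Local Open Scope ring_scope.

(** The proof reduces the geometry to three facts about functions of an angle.
    Let [q] be the support function of the image lines and [a] the logarithm of
    the ratio of opposite radii; both are smooth and change sign under the shift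
    by [pi].  The cusps are the zeros of [q + q''], the affine chords through [p]
    are the zeros of [q], the centred chords are the zeros of [a], and a zero of
    [a'] at [phi] is a zero of [q] at [phi + pi / 2]; everything is counted
    modulo [pi].

    Centred chords are at most as many as affine chords by Rolle's theorem
    between cyclically consecutive zeros of [a] ([rolle_mod_pi]).

    For the cusps, the tool is the Wronskian [W = q' sin (_ - c) - q cos (_ - c)],
    whose derivative is [(q + q'') sin (_ - c)].  If [z < z'] are consecutive
    zeros of [q] and [z' - z < pi], then with [c = z] one has [W z = 0] and
    [W z' = q'(z') sin (z' - z)], so [q + q''] somewhere takes the sign opposite
    to that of [q] on this arch.  The signs of [q] alternate from arch to arch,
    hence [q + q''] changes sign at least once per arch
    ([zeros_le_zeros_radius_fun]).  There are at least three cusps because their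
    number is odd, by antiperiodicity, and a single one at [c] would make [W]
    monotone on [[c, c + pi]] although [W c = W (c + pi)]
    ([three_le_zeros_radius_fun]).

    It remains to see that [q] exists and is smooth.  Three plane vectors turn
    counterclockwise with nonzero speed and take each direction once per period:
    the outward normal of the oval, the vector from [p] to the oval, and the
    image of a chord through [p].  A general lemma ([angle_lift_exists]) gives
    each of them a smooth angle with a smooth inverse.  The first angle
    parametrizes the oval so that [iota] is the shift by [pi]; the second one
    describes the pencil of [p]; the third one shows that each normal direction
    belongs to one image line.  That an image chord takes no direction twice,
    and that [q] vanishes only at affine chords, both follow from the fact that
    points of the oval in cyclic order form positively oriented triangles
    ([orientation]): interlacing chords cross and disjoint chords do not. *)

(** * Smooth functions of a real variable *)

Section smooth_calculus.
Context {R : realType}.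
Implicit Types f g : R -> R.

Lemma is_derive_add f g (x a b : R) : is_derive x 1 f a -> is_derive x 1 g b ->
  is_derive x 1 (fun y : R => f y + g y) (a + b : R).
Proof. by move=> df dg; exact: (@is_deriveD _ _ _ f g). Qed.

Lemma is_derive_opp f (x a : R) : is_derive x 1 f a ->
  is_derive x 1 (fun y : R => - f y) (- a : R).
Proof. by move=> df; exact: (@is_deriveN _ _ _ f). Qed.

Lemma is_derive_sub f g (x a b : R) : is_derive x 1 f a -> is_derive x 1 g b ->
  is_derive x 1 (fun y : R => f y - g y) (a - b : R).
Proof. by move=> df dg; exact: (@is_deriveB _ _ _ f g). Qed.

Lemma is_derive_mul f g (x a b : R) : is_derive x 1 f a -> is_derive x 1 g b ->
  is_derive x 1 (fun y : R => f y * g y) (a * g x + f x * b : R).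
Proof.
move=> df dg; rewrite (_ : _ + _ = f x * b + g x * a); first exact: (@is_deriveM _ _ f g).
by rewrite addrC [a * _]mulrC.
Qed.

Lemma is_derive_inv f (x a : R) : f x != 0 -> is_derive x 1 f a ->
  is_derive x 1 (fun y : R => (f y)^-1) (- (f x ^+ 2)^-1 * a : R).
Proof. by move=> fx0 df; exact: (is_deriveV fx0 df). Qed.

Lemma is_derive_chain f g (x a b : R) :
  is_derive (g x) 1 f a -> is_derive x 1 g b ->
  is_derive x 1 (fun y : R => f (g y)) (a * b : R).
Proof. exact: is_derive1_comp. Qed.

Lemma is_derive_const (c x : R) : is_derive x 1 (fun _ : R => c) 0.
Proof. exact: (@is_derive_cst _ _ _ c). Qed.

Lemma is_derive_var (x : R) : is_derive x 1 (fun y : R => y) 1.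
Proof. exact: is_derive_id. Qed.

Lemma is_derive_translate f (c x a : R) : is_derive (x + c) 1 f a ->
  is_derive x 1 (fun y : R => f (y + c)) a.
Proof.
move=> df; have dc : is_derive x 1 (fun y : R => y + c) (1 + 0).
  exact: is_derive_add (is_derive_var x) (is_derive_const c x).
by have := @is_derive_chain f (fun y => y + c) _ _ _ df dc; rewrite addr0 mulr1.
Qed.

Lemma is_derive_uniq f (x a b : R) :
  is_derive x 1 f a -> is_derive x 1 f b -> a = b.
Proof. by move=> da db; rewrite -(@derive_val _ _ _ _ _ _ _ da) (@derive_val _ _ _ _ _ _ _ db). Qed.

Lemma is_derive1E f (x a : R) : is_derive x 1 f a -> derive1 f x = a.
Proof. by move=> da; rewrite derive1E (@derive_val _ _ _ _ _ _ _ da). Qed.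

Lemma is_derive_cont f (x a : R) : is_derive x 1 f a -> {for x, continuous f}.
Proof. by move=> [df _]; exact/differentiable_continuous/derivable1_diffP. Qed.

Lemma continuous_itv f (a b : R) : continuous f -> {within `[a, b], continuous f}.
Proof. by move=> cf; apply: continuous_subspaceT => x; exact: cf. Qed.

Lemma mean_value f (f' : R -> R) (a b : R) : a < b ->
  (forall x : R, is_derive x 1 f (f' x)) ->
  exists2 c, a < c < b & f b - f a = f' c * (b - a).
Proof.
move=> ab df.
have cf : {within `[a, b], continuous f}.
  by apply: continuous_itv => x; exact: is_derive_cont (df x).
by have [c + e] := @MVT _ f f' a b ab (fun x _ => df x) cf; rewrite in_itv; exists c.
Qed.

Lemma derive_gt0_mono f (f' : R -> R) : (forall x : R, is_derive x 1 f (f' x)) ->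
  (forall x, 0 < f' x) -> {mono f : x y / x < y}.
Proof.
move=> df f'0.
have H : {homo f : x y / x < y}.
  move=> x y xy; have [c _ e] := mean_value xy df.
  by rewrite -subr_gt0 e mulr_gt0 // subr_gt0.
exact/leW_mono/le_mono.
Qed.

(** Asking for some derivative at each stage, instead of following the chain of
    [derive1n], lets the closure properties below go by induction on [n] with
    the usual formulas as witnesses. *)
Fixpoint Cn (n : nat) f : Prop :=
  if n is m.+1 then exists2 f', (forall x : R, is_derive x 1 f (f' x)) & Cn m f'
  else True.

Lemma CnS n f : Cn n.+1 f -> Cn n f.
Proof.
elim: n f => // n IH f [f' df Cf']; exists f' => //; exact: IH.
Qed.

(** An inductive wrapper rather than a bare quantification, so that unification
    never opens it. *)
Inductive Cinf f : Prop := CinfI of forall n, Cn n f.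

Lemma CinfP f : Cinf f <-> forall n, Cn n f.
Proof. by split => [[]|/CinfI]. Qed.

Lemma Cinf_is_derive f : Cinf f -> forall x : R, is_derive x 1 f (derive1 f x).
Proof.
move=> [/(_ 1%N)[f' df _]] x.
by rewrite (is_derive1E (df x)).
Qed.

Lemma Cinf_derive1 f : Cinf f -> Cinf (derive1 f).
Proof.
move=> [Cf]; split => n; have [f' df Cf'] := Cf n.+1.
by rewrite (_ : derive1 f = f') //; apply/funext => y; exact: is_derive1E (df y).
Qed.

Lemma smoothP f : smooth f <-> Cinf f.
Proof.
split=> [sf|Cf n].
  split=> n; elim: n f sf => // n IH f sf; exists (derive1 f).
    by move=> x; rewrite derive1E; apply: DeriveDef => //; exact: (sf 0%N).
  by apply: IH => m x; rewrite -derive1Sn.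
elim: n f Cf => [|n IH] f Cf x; first by have [] := Cinf_is_derive Cf x.
by rewrite derive1Sn; apply: IH; exact: Cinf_derive1.
Qed.

Lemma Cinf_continuous f : Cinf f -> continuous f.
Proof. by move=> sf x; exact: is_derive_cont (Cinf_is_derive sf x). Qed.

Lemma Cinf_primitive f (f' : R -> R) : (forall x : R, is_derive x 1 f (f' x)) ->
  Cinf f' -> Cinf f.
Proof.
by move=> df /CinfP sf'; apply/CinfP => -[//|n]; exists f'.
Qed.

Lemma Cinf_cst (c : R) : Cinf (fun _ : R => c).
Proof.
suff H n : forall c, Cn n (fun _ : R => c) by apply/CinfP => n; exact: H.
elim: n => // n IH {}c; exists (fun=> 0) => // x; exact: is_derive_const.
Qed.

Lemma Cinf_id : Cinf (fun x : R => x).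
Proof. exact: (@Cinf_primitive _ (fun=> 1) is_derive_var (@Cinf_cst 1)). Qed.

Lemma CnD n f g : Cn n f -> Cn n g -> Cn n (fun x => f x + g x).
Proof.
elim: n f g => // n IH f g [f' df Cf] [g' dg Cg].
by exists (fun x => f' x + g' x); [move=> x; exact: is_derive_add|exact: IH].
Qed.

Lemma CinfD f g : Cinf f -> Cinf g -> Cinf (fun x => f x + g x).
Proof. by move=> /CinfP sf /CinfP sg; apply/CinfP => n; exact: CnD. Qed.

Lemma CnM n f g : Cn n f -> Cn n g -> Cn n (fun x => f x * g x).
Proof.
elim: n f g => // n IH f g Hf Hg.
have [f' df Cf] := Hf; have [g' dg Cg] := Hg.
exists (fun x => f' x * g x + f x * g' x); first by move=> x; exact: is_derive_mul.
by apply: CnD; apply: IH => //; exact: CnS.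
Qed.

Lemma CinfM f g : Cinf f -> Cinf g -> Cinf (fun x => f x * g x).
Proof. by move=> /CinfP sf /CinfP sg; apply/CinfP => n; exact: CnM. Qed.

Lemma CinfN f : Cinf f -> Cinf (fun x => - f x).
Proof.
move=> sf; rewrite (_ : (fun _ => _) = (fun x => -1 * f x)).
  by apply: CinfM => //; exact: Cinf_cst.
by apply/funext => x; rewrite mulN1r.
Qed.

Lemma CinfB f g : Cinf f -> Cinf g -> Cinf (fun x => f x - g x).
Proof. by move=> sf sg; apply: CinfD => //; exact: CinfN. Qed.

Lemma CnV n f : (forall x, f x != 0) -> Cn n f -> Cn n (fun x => (f x)^-1).
Proof.
move=> f0; elim: n => // n IH Hf; have [f' df Cf] := Hf.
exists (fun x => - (f x)^-1 * (f x)^-1 * f' x).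
  move=> x; rewrite (_ : _ * _ = - (f x ^+ 2)^-1 * f' x).
    exact: is_derive_inv (f0 x) (df x).
  by rewrite expr2 invfM mulNr.
apply: CnM => //; apply: CnM; last exact/IH/CnS.
rewrite (_ : (fun _ => _) = (fun x => -1 * (f x)^-1)).
  apply: CnM; first by move/CinfP: (@Cinf_cst (-1)).
  exact/IH/CnS.
by apply/funext => x; rewrite mulN1r.
Qed.

Lemma CinfV f : (forall x, f x != 0) -> Cinf f -> Cinf (fun x => (f x)^-1).
Proof. by move=> f0 /CinfP sf; apply/CinfP => n; exact: CnV. Qed.

Lemma Cn_comp n f g : Cinf f -> Cn n g -> Cn n (fun x => f (g x)).
Proof.
elim: n f g => // n IH f g sf Hg; have [g' dg Cg] := Hg.
exists (fun x => derive1 f (g x) * g' x).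
  by move=> x; apply: is_derive_chain => //; exact: Cinf_is_derive.
by apply: CnM => //; apply: IH; [exact: Cinf_derive1|exact: CnS].
Qed.

Lemma Cinf_comp f g : Cinf f -> Cinf g -> Cinf (fun x => f (g x)).
Proof. by move=> sf /CinfP sg; apply/CinfP => n; exact: Cn_comp. Qed.

Lemma Cinf_shift f (c : R) : Cinf f -> Cinf (fun x => f (x + c)).
Proof.
move=> sf; apply: Cinf_comp => //.
by apply: CinfD; [exact: Cinf_id|exact: Cinf_cst].
Qed.

Lemma Cinf_cos_sin : Cinf (@cos R) /\ Cinf (@sin R).
Proof.
suff H n : Cn n (@cos R) /\ Cn n (fun x : R => - sin x) /\ Cn n (@sin R).
  by split; apply/CinfP => n; have [? []] := H n.
elim: n => // n [Cc [CNs Cs]].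
have CNc : Cn n (fun x : R => - cos x).
  rewrite (_ : (fun _ => _) = (fun x => -1 * cos x)).
    by apply: CnM => //; move/CinfP: (@Cinf_cst (-1)).
  by apply/funext => x; rewrite mulN1r.
split; first by exists (fun x => - sin x) => // x; exact: is_derive_cos.
split.
  exists (fun x => - cos x) => // x.
  exact: (@is_derive_opp (@sin R) _ _ (is_derive_sin x)).
by exists cos => // x; exact: is_derive_sin.
Qed.

Lemma Cinf_cos f : Cinf f -> Cinf (fun x => cos (f x)).
Proof. by move=> sf; apply: Cinf_comp => //; have [] := Cinf_cos_sin. Qed.

Lemma Cinf_sin f : Cinf f -> Cinf (fun x => sin (f x)).
Proof. by move=> sf; apply: Cinf_comp => //; have [] := Cinf_cos_sin. Qed.

(** Differentiating [f (g x) = x] gives [g' = 1 / (f' o g)], which is one degree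
    more regular than what is already known of [g]: hence the induction. *)
Lemma Cinf_inverse f g : Cinf f -> (forall x, derive1 f x != 0) ->
  cancel f g -> cancel g f -> Cinf g.
Proof.
move=> sf f'0 fK gK.
have dg (y : R) : is_derive y 1 g (derive1 f (g y))^-1.
  rewrite -{1}[y]gK; apply: is_derive_inverse => //.
  - by near=> z; exact: fK.
  - by near=> z; exact: Cinf_continuous.
  - exact: Cinf_is_derive.
apply/CinfP; elim=> // n IH; exists (fun y => (derive1 f (g y))^-1) => //.
by apply: (@CnV n (fun y => derive1 f (g y))) => //; apply: Cn_comp => //; exact: Cinf_derive1.
Unshelve. all: by end_near. Qed.

Lemma derive1_translate f (c x : R) : Cinf f ->
  derive1 (fun y => f (y + c)) x = derive1 f (x + c).
Proof.
by move=> Cf; exact: is_derive1E (is_derive_translate (Cinf_is_derive Cf _)).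
Qed.

Lemma derive1_periodic f (P x : R) : Cinf f -> (forall t, f (t + P) = f t) ->
  derive1 f (x + P) = derive1 f x.
Proof.
move=> Cf pf; rewrite -(derive1_translate P x Cf).
by congr (derive1 _ x); apply/funext.
Qed.

(** [fun x => \int_(-N)^x f - \int_(-N)^0 f] is independent of [N] as soon as
    [-N] is to the left of [x] and [0], so these functions glue to a primitive
    on the whole line. *)
Lemma continuous_has_primitive f : continuous f ->
  exists F : R -> R, forall x : R, is_derive x 1 F (f x).
Proof.
move=> cf.
pose mu := @lebesgue_measure R.
pose I (N x : R) := (\int[mu]_(t in `[(- N)%R, x]) f t)%R.
have fi (a b : R) : mu.-integrable `[a, b] (EFin \o f).
  apply: continuous_compact_integrable; first exact: segment_compact.
  exact: (@continuous_itv f).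
have IB (N M x : R) : M <= N -> - M <= x -> I N x - I N (- M) = I M x.
  move=> MN Mx; rewrite /I.
  rewrite (@Rintegral_itvB R f (BLeft (- N)) (BRight x) (- M) (fi _ _)).
  - rewrite Rintegral_itv_obnd_cbnd //.
    apply: integrableS (fi (- M) x) => //.
    by apply: subset_itvr; rewrite bnd_simp.
  - by rewrite bnd_simp lerN2.
  - by rewrite bnd_simp.
pose F x := I (`|x| + 1) x - I (`|x| + 1) 0.
have FE (N x : R) : `|x| + 1 <= N -> F x = I N x - I N 0.
  move=> xN; rewrite /F -(IB N) //; last first.
    by rewrite lerNl; have := ler_norm (- x); rewrite normrN; lra.
  rewrite -(IB N (`|x| + 1) 0) //; ring.
exists F => x.
pose N := `|x| + 2.
have xx1 : x < x + 1 by rewrite ltrDl.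
have Nx : - N < x by rewrite /N ltrNl; have := ler_norm (- x); rewrite normrN; lra.
have [dI eI] := @continuous_FTC1_closed R f (- N) x (x + 1) xx1 (fi _ _) Nx (cf x).
have dF : is_derive x 1 (fun y : R => I N y - I N 0) (f x).
  have dN : is_derive x 1 (I N) (f x) by rewrite -eI derive1E; apply: DeriveDef.
  by have := is_derive_sub dN (is_derive_const (I N 0) x); rewrite subr0.
have eF : {near x, (fun y => I N y - I N 0) =1 F}.
  near=> y; rewrite (FE N) // /N.
  suff : `|y - x| < 1 by have := ler_normD (y - x) x; rewrite subrK; lra.
  by near: y; apply: cvgr_distC_lt; [exact: cvg_id|].
move: dF => [dF1 dF2].
apply: DeriveDef; first exact: near_eq_derivable eF dF1.
by rewrite -dF2; apply/esym/near_eq_derive.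
Unshelve. all: by end_near. Qed.
End smooth_calculus.

(** * Periodicity and angles *)

Section periodicity_and_trigonometry.
Context {R : realType}.
Local Notation pi := (@pi R).

Lemma reduce_modulo (P t : R) : 0 < P -> exists k : int, 0 <= t + P * k%:~R < P.
Proof.
move=> P0; exists (- Num.floor (t / P)).
have /andP[h1 h2] := floor_itv (t / P).
move: h1 h2; rewrite ler_pdivlMr // ltr_pdivrMr // rmorphN /= intrD => h1 h2.
by apply/andP; split; nra.
Qed.

Lemma periodic_int (T : Type) (f : R -> T) (P : R) (k : int) t :
  (forall t, f (t + P) = f t) -> f (t + P * k%:~R) = f t.
Proof.
move=> pf; elim: k t => [t|n IH t|n IH t]; first by rewrite mulr0 addr0.
  have -> : t + P * (n.+1%:Z)%:~R = t + P * n%:~R + P.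
    by rewrite intS intrD; ring.
  by rewrite pf.
have e : t + P * (- n.+1%:Z)%:~R + P = t + P * (- n%:Z)%:~R.
  by rewrite intS opprD intrD; ring.
by rewrite -pf e; exact: IH.
Qed.

Lemma two_pi_gt0 : 0 < pi *+ 2.
Proof. by rewrite mulrn_wgt0 // pi_gt0. Qed.

Lemma two_piE : pi *+ 2 = pi + pi.
Proof. exact: mulr2n. Qed.

Lemma sin_eq0_in (d : R) : 0 <= d < pi *+ 2 -> sin d = 0 -> d = 0 \/ d = pi.
Proof.
move=> /andP[d0 d2] sd; have [->|dn0] := eqVneq d 0; first by left.
have [->|dnp] := eqVneq d pi; first by right.
have [dp|dp] := ltP d pi.
  suff : 0 < sin d by rewrite sd ltxx.
  by apply: sin_gt0_pi; rewrite lt_def dn0 d0.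
have : 0 < sin (d - pi).
  apply: sin_gt0_pi; move: dnp dp d2; rewrite -mulr_natr => dnp dp d2.
  have : pi != d by rewrite eq_sym.
  move=> h; have {}dp : pi < d by rewrite lt_neqAle h.
  by apply/andP; split; lra.
have := sinDpi (d - pi); rewrite subrK sd => /eqP; rewrite eq_sym oppr_eq0.
by move=> /eqP ->; rewrite ltxx.
Qed.

Lemma sin_eq0_mod (d : R) : sin d = 0 ->
  exists k : int, d = pi *+ 2 * k%:~R \/ d = pi + pi *+ 2 * k%:~R.
Proof.
move=> sd; have [k hk] := reduce_modulo d two_pi_gt0.
have s0 : sin (d + pi *+ 2 * k%:~R) = 0 by rewrite (periodic_int k _ (@sinD2pi R)).
exists (- k); rewrite rmorphN /=.
by have [e|e] := sin_eq0_in hk s0; [left|right]; lra.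
Qed.

Lemma sin_sub_eq0_inj (s t : R) : 0 <= s < pi -> 0 <= t < pi ->
  sin (t - s) = 0 -> s = t.
Proof.
wlog st : s t / s < t => [H|].
  move=> hs ht e; case: (ltgtP s t) => // st; first exact: H.
  by apply/esym/H => //; rewrite -opprB sinN e oppr0.
move=> /andP[s0 sp] /andP[t0 tp] e.
have : 0 < sin (t - s) by apply: sin_gt0_pi; apply/andP; split; lra.
by rewrite e ltxx.
Qed.

Lemma unit_circle_angle (c s : R) : c ^+ 2 + s ^+ 2 = 1 ->
  exists a, cos a = c /\ sin a = s.
Proof.
move=> cs.
have c1 : -1 <= c <= 1.
  rewrite -ler_norml -(@ler_pXn2r _ 2) ?nnegrE // expr1n -normrX.
  by rewrite ger0_norm ?sqr_ge0 // -cs lerDl sqr_ge0.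
have acosc : cos (acos c) = c by apply: acosK; rewrite in_itv.
have sacos : sin (acos c) = `|s|.
  rewrite sin_acos // -sqrtr_sqr; congr Num.sqrt.
  by rewrite -cs addrAC subrr add0r.
case: (leP 0 s) => s0.
  by exists (acos c); rewrite sacos ger0_norm.
by exists (- acos c); rewrite cosN sinN sacos ltr0_norm // opprK.
Qed.

Lemma polar_angle (x y : R) : 0 < x ^+ 2 + y ^+ 2 ->
  exists a l, [/\ 0 < l, x = l * cos a & y = l * sin a].
Proof.
move=> xy; pose l := Num.sqrt (x ^+ 2 + y ^+ 2).
have l0 : 0 < l by rewrite sqrtr_gt0.
have l2 : l ^+ 2 = x ^+ 2 + y ^+ 2 by rewrite sqr_sqrtr // ltW.
have [|a [ca sa]] := @unit_circle_angle (x / l) (y / l).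
  by rewrite !expr_div_n -mulrDl -l2 divff // expf_neq0 // gt_eqF.
by exists a, l; rewrite ca sa ![l * _]mulrC !divfK // gt_eqF.
Qed.

(** The half-angle formula [cos d = 1 - 2 sin (d / 2) ^ 2]. *)
Lemma cos_eq1_ge2pi (d : R) : 0 < d -> cos d = 1 -> pi *+ 2 <= d.
Proof.
move=> d0 cd; rewrite leNgt; apply/negP => d2.
have s0 : 0 < sin (d / 2).
  apply: sin_gt0_pi; rewrite divr_gt0 //= ltr_pdivrMr //.
  by rewrite mulr_natr.
have : cos (d / 2 *+ 2) = 1 by rewrite -mulr_natr divfK.
rewrite cos_mulr2n => e.
have := cos2Dsin2 (d / 2); nra.
Qed.

End periodicity_and_trigonometry.

(** * Simple zeros *)

Section zeros.
Context {R : realType}.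
Implicit Types f : R -> R.

Lemma continuous_zero_between f (a b : R) : continuous f -> a < b ->
  f a * f b < 0 -> exists2 c, a < c < b & f c = 0.
Proof.
move=> cf ab fab.
have f0 : Num.min (f a) (f b) <= 0 <= Num.max (f a) (f b).
  rewrite ge_min le_max; move: fab; case: (ltP (f a) 0) => fa fab.
    by rewrite ltW //= ltW ?orbT //; nra.
  have fb : f b < 0 by nra.
  by rewrite (ltW fb) orbT.
have [c cab fc] := IVT (ltW ab) (continuous_itv (a := a) (b := b) cf) f0.
have ca : a != c by apply/eqP => e; move: fab; rewrite e fc mul0r ltxx.
have cb : c != b by apply/eqP => e; move: fab; rewrite -e fc mulr0 ltxx.
exists c => //; move: cab; rewrite in_itv /= => /andP[ac bc].
by rewrite !lt_neqAle ca cb ac.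
Qed.

(** The slope from [a], continuously extended by [d], keeps the sign of [d] near
    [a]: a simple zero is isolated and is a change of sign. *)
Lemma simple_zero_sign f (a d : R) : is_derive a 1 f d -> f a = 0 -> d != 0 ->
  exists2 e : R, 0 < e & forall t, t != a -> `|t - a| < e -> 0 < f t * d * (t - a).
Proof.
move=> /is_derive1_caratheodory[g [fE cg ga]] fa d0.
have /cvgr_dist_lt/(_ `|d|) : g x @[x --> a] --> d by rewrite -ga.
rewrite normr_gt0 => /(_ d0) /nbhs_ballP[e /= e0 He].
exists e => // t ta tae.
have : `|d - g t| < `|d| by apply: He; rewrite /ball /= distrC.
move: (fE t); rewrite fa subr0 => -> gd.
have t2 : 0 < (t - a) ^+ 2 by rewrite exprn_even_gt0 //= subr_eq0.
have -> : g t * (t - a) * d * (t - a) = g t * d * (t - a) ^+ 2 by ring.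
rewrite mulr_gt0 //.
move: gd; case: (ltgtP d 0) d0 => // d0 _.
  rewrite (ltr0_norm d0) ltr_norml => /andP[? ?]; have : g t < 0 by lra.
  by nra.
rewrite (gtr0_norm d0) ltr_norml => /andP[? ?]; have : 0 < g t by lra.
by nra.
Qed.

(** By convention [derive1] is [0] where the difference quotient diverges, so a
    nonzero value certifies differentiability. *)
Lemma derive1_neq0_is_derive f (a : R) : derive1 f a <> 0 ->
  is_derive a 1 f (derive1 f a).
Proof.
move=> f'a; rewrite derive1E; apply: DeriveDef => //.
apply: contrapT => ncv; apply: f'a; rewrite derive1E /derive dvgP //.
Qed.

(** By continuity a limit point of zeros is a zero, but simple zeros are
    isolated. *)
Lemma finite_simple_zeros f (a b : R) : continuous f -> simple_zeros f ->
  finite_set [set t | a <= t < b /\ f t = 0].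
Proof.
move=> cf sf; apply: contrapT => inf.
have [|l /limit_point_infinite_setP ll] := infinite_bounded_limit_point_nonempty inf.
  exists (Num.max `|a| `|b|); split => //= M hM t [/andP[at_ tb] _].
  apply: ltW; apply: le_lt_trans hM; rewrite ler_norml.
  have := ler_norm b; have := ler_norm (- a); rewrite normrN => h1 h2.
  by rewrite lerNl; apply/andP; split; rewrite le_max; apply/orP;
    [left|right]; lra.
have near_zero (e : R) : 0 < e -> exists t, [/\ t != l, `|t - l| < e & f t = 0].
  move=> e0; apply: contrapT => nt.
  have : infinite_set ((ball l e) `&` [set t | a <= t < b /\ f t = 0]).
    by apply: ll; exact: nbhsx_ballx.
  apply; apply: (@sub_finite_set _ _ [set l]); last exact: finite_set1.
  move=> t [/= lt [_ ft]]; apply: contrapT => /eqP tl; apply: nt; exists t.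
  by split => //; rewrite distrC.
have fl : f l = 0.
  apply: contrapT => /eqP fl.
  have /cvgr_dist_lt/(_ `|f l|) : f x @[x --> l] --> f l by exact: cf.
  rewrite normr_gt0 => /(_ fl) /nbhs_ballP[e /= e0 He].
  have [t [_ te ft]] := near_zero _ e0.
  have : `|f l - f t| < `|f l| by apply: He; rewrite /ball /= distrC.
  by rewrite ft subr0 ltxx.
have [_ f'l] := sf _ fl.
have [e e0 He] := simple_zero_sign (derive1_neq0_is_derive f'l) fl (introN eqP f'l).
have [t [tl te ft]] := near_zero _ e0.
by have := He _ tl te; rewrite ft !mul0r ltxx.
Qed.

(** The function leaves the first zero and reaches the second one on the same
    side of [0], since it does not vanish in between. *)
Lemma consecutive_zeros_derive f (a b da db : R) : continuous f -> a < b ->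
  f a = 0 -> f b = 0 -> (forall t, a < t < b -> f t <> 0) ->
  is_derive a 1 f da -> is_derive b 1 f db -> da != 0 -> db != 0 ->
  da * db < 0.
Proof.
move=> cf ab fa fb nz fda fdb da0 db0.
have [e1 e10 H1] := simple_zero_sign fda fa da0.
have [e2 e20 H2] := simple_zero_sign fdb fb db0.
pose d := Num.min (Num.min e1 e2) (b - a) / 3.
have d0 : 0 < d by rewrite divr_gt0 // !lt_min e10 e20 subr_gt0 ab.
have d1 : d < e1.
  suff : d * 3 <= e1 by lra.
  by rewrite divfK // !ge_min lexx.
have d2 : d < e2.
  suff : d * 3 <= e2 by lra.
  by rewrite divfK // !ge_min lexx orbT.
have d3 : d * 3 <= b - a by rewrite divfK // ge_min lexx orbT.
have := H1 (a + d); rewrite addrAC subrr add0r gtr0_norm // => /(_ _ d1) h1.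
have := H2 (b - d); rewrite addrAC subrr add0r normrN gtr0_norm // => /(_ _ d2) h2.
have {}h1 : 0 < f (a + d) * da * d by apply: h1; rewrite gt_eqF // ltrDl.
have {}h2 : 0 < f (b - d) * db * - d by apply: h2; rewrite lt_eqF // ltrBlDr ltrDl.
have {}h1 : 0 < f (a + d) * da by nra.
have {}h2 : f (b - d) * db < 0 by nra.
rewrite ltNge; apply/negP => dd.
have ff : f (a + d) * f (b - d) < 0.
  have : (f (a + d) * da) * (f (b - d) * db) < 0 by nra.
  rewrite (_ : _ * _ = (f (a + d) * f (b - d)) * (da * db)); last by ring.
  by nra.
have [|c /andP[c1 c2] fc] := continuous_zero_between cf _ ff; first lra.
by apply: (nz c) fc; lra.
Qed.

End zeros.

(** * Counting zeros modulo pi *)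

Section counting_modulo_pi.
Context {R : realType}.
Local Notation pi := (@pi R).

Definition mod_pi (Z : set R) : set R := [set t | 0 <= t < pi /\ Z t].

Definition pi_periodic (Z : set R) := forall t, Z (t + pi) <-> Z t.

Lemma pi_periodic_int Z (k : int) t : pi_periodic Z -> Z (t + pi * k%:~R) <-> Z t.
Proof.
move=> pZ; rewrite (_ : Z (t + pi * k%:~R) = Z t) //.
by apply: (periodic_int k t (f := Z)) => u; exact/propext/pZ.
Qed.

(** The [n] points found in the successive intervals lie in a window of length
    [pi], where reduction modulo [pi] is injective. *)
Lemma mod_pi_card_ge (Z : set R) (n N : nat) (m : nat -> R) :
  pi_periodic Z -> mod_pi Z #= `I_N ->
  (forall i, (i < n)%N -> exists2 c, m i < c < m i.+1 & Z c) ->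
  m n <= m 0%N + pi -> (n <= N)%N.
Proof.
move=> pZ ZN Hc mn; have p0 := pi_gt0 R.
have /choice[c Hc'] : forall i, exists c, (i < n)%N -> m i < c < m i.+1 /\ Z c.
  by move=> i; case: (ltnP i n) => [/Hc[c ? ?]|_]; [exists c|exists 0].
have /choice[k Hk] := fun t => reduce_modulo t p0.
have m_le i j : (i <= j)%N -> (j <= n)%N -> m i <= m j.
  elim: j => [|j IH]; first by case: i.
  rewrite leq_eqVlt => /predU1P[-> //|]; rewrite ltnS => ij jn.
  apply: le_trans (IH ij (ltnW jn)) _.
  by have [/andP[? ?] _] := Hc' _ jn; lra.
have c_lt i j : (i < j)%N -> (j < n)%N -> c i < c j.
  move=> ij jn; have [/andP[_ h1] _] := Hc' _ (ltn_trans ij jn).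
  have [/andP[h2 _] _] := Hc' _ jn; have := m_le _ _ ij (ltnW jn); lra.
have c_win i : (i < n)%N -> m 0%N < c i < m n.
  move=> iln; have [/andP[h1 h2] _] := Hc' _ iln.
  have := m_le 0%N i isT (ltnW iln); have := m_le i.+1 n iln (leqnn _).
  by move=> ? ?; apply/andP; split; lra.
pose w i := c i + pi * (k (c i))%:~R.
rewrite -card_le_II -(card_le_eqr ZN).
have winj : {in `I_n &, injective w}.
  move=> i j; rewrite !inE /= => iln jn wij.
  have kk : k (c i) = k (c j).
    have /andP[a1 a2] := c_win _ iln; have /andP[b1 b2] := c_win _ jn.
    have e : c i - c j = pi * (k (c j) - k (c i))%:~R.
      by move: wij; rewrite /w intrB mulrBr => wij; lra.
    have lt1 : (k (c j) - k (c i))%:~R < 1 :> R by nra.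
    have lt2 : -1 < (k (c j) - k (c i))%:~R :> R by nra.
    move: lt1 lt2; rewrite (_ : 1 = 1%:~R) // -(rmorphN _ 1) /= !ltr_int; lia.
  move: wij; rewrite /w kk => /addIr cij.
  by apply/eqP; case: (ltngtP i j) => // ij; have := c_lt _ _ ij;
    rewrite cij ltxx => /(_ _)/wrap[].
rewrite -(card_le_eql (inj_card_eq winj)); apply: subset_card_le.
move=> _ [i /= iln <-]; split; first exact: Hk.
by apply/pi_periodic_int => //; have [] := Hc' _ iln.
Qed.

(** The zeros of a [pi]-periodic set as one increasing sequence, obtained by
    repeating with period [pi] those of [ [0, pi) ]. *)
Lemma mod_pi_enum (Z : set R) (n : nat) : pi_periodic Z ->
  mod_pi Z #= `I_n -> (0 < n)%N ->
  exists z : nat -> R, [/\ forall i, Z (z i), forall i, z i < z i.+1,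
    forall i, z (i + n)%N = z i + pi & forall i t, z i < t < z i.+1 -> ~ Z t].
Proof.
move=> pZ Zn n0; have p0 := pi_gt0 R.
pose s := sort <=%O (finmap.enum_fset (fset_set (mod_pi Z))).
have fZ : finite_set (mod_pi Z) by apply/finite_setP; exists n.
have memE t : (t \in s) <-> mod_pi Z t.
  by rewrite mem_sort in_fset_set // inE.
have ss : sorted <%O s by rewrite sort_lt_sorted finmap.fset_uniq.
have sn : size s = n by rewrite size_sort (card_fset_set Zn).
have s_in i : (i < n)%N -> mod_pi Z s`_i.
  by move=> iln; apply/memE; rewrite mem_nth // sn.
have s_lt i j : (i < j)%N -> (j < n)%N -> s`_i < s`_j.
  move=> ij jn; apply: (sorted_ltn_nth lt_trans) => //; rewrite inE sn //.
  exact: ltn_trans jn.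
have lt_s i j : (i < n)%N -> (j < n)%N -> s`_i < s`_j -> (i < j)%N.
  move=> iln jn; case: (ltngtP i j) => // [ji|->]; last by rewrite ltxx.
  by move=> h; have := s_lt _ _ ji iln; lra.
(* the sorted zeros of [ [0, pi) ], repeated with period [pi] *)
pose z i := s`_(i %% n) + pi * (i %/ n)%:R.
have zS i : (i.+1 %% n = (i %% n).+1 /\ i.+1 %/ n = i %/ n /\ (i %% n).+1 < n)%N \/
    (i.+1 %% n = 0 /\ i.+1 %/ n = (i %/ n).+1 /\ (i %% n).+1 = n)%N.
  have := ltn_pmod i n0; rewrite leq_eqVlt => /predU1P[h|h]; [right|left].
    have e : i.+1 = ((i %/ n).+1 * n)%N.
      by rewrite {1}(divn_eq i n) -addnS h mulSn addnC.
    by rewrite e modnMl mulnK.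
  have e : i.+1 = (i %/ n * n + (i %% n).+1)%N.
    by rewrite {1}(divn_eq i n) -addnS.
  by rewrite e modnMDl divnMDl // (modn_small h) (divn_small h) addn0.
have shift t (j : nat) : Z (t + pi * j%:R) <-> Z t.
  exact: (@pi_periodic_int Z j t pZ).
exists z; split.
- by move=> i; apply/shift; have [] := s_in _ (ltn_pmod i n0).
- move=> i; rewrite /z; case: (zS i) => [[-> [-> h]]|[-> [-> h]]].
    by rewrite ltrD2r; exact: s_lt.
  have [/andP[_ h1] _] := s_in _ (ltn_pmod i n0).
  have [/andP[h2 _] _] := s_in _ n0.
  by rewrite -natr1 mulrDr mulr1; lra.
- by move=> i; rewrite /z modnDr divnDr // divnn n0 addn1 -natr1; ring.
move=> i t /andP[t1 t2] Zt.
pose u := t + pi * (- (i %/ n)%:Z)%:~R.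
have Zu : Z u by apply/pi_periodic_int.
have tu : t = u + pi * (i %/ n)%:R by rewrite /u rmorphN /=; ring.
move: t1 t2; rewrite /z tu ltrD2r.
have [/andP[a1 a2] _] := s_in _ (ltn_pmod i n0).
case: (zS i) => [[-> [-> h]]|[-> [-> h]]] t1.
  rewrite ltrD2r => t2.
  have [/andP[b1 b2] _] := s_in _ h.
  have /memE/(nthP 0)[j] : mod_pi Z u by split => //; apply/andP; split; lra.
  rewrite sn => jn uj; move: t1 t2; rewrite -uj.
  by move=> /(lt_s _ _ (ltn_pmod i n0) jn) h1 /(lt_s _ _ jn h) h2; lia.
rewrite -natr1 mulrDr mulr1 => t2.
have {}t2 : u < s`_0 + pi by lra.
have [/andP[b1 b2] _] := s_in _ n0.
case: (ltP u pi) => up.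
  have /memE/(nthP 0)[j] : mod_pi Z u by split => //; apply/andP; split; lra.
  rewrite sn => jn uj; move: t1; rewrite -uj.
  by move=> /(lt_s _ _ (ltn_pmod i n0) jn) h1; lia.
have /memE/(nthP 0)[j] : mod_pi Z (u - pi).
  by split; [apply/andP; split; lra|apply/pZ; rewrite subrK].
rewrite sn => jn uj.
have /(lt_s _ _ jn n0) : s`_j < s`_0 by rewrite uj; lra.
by rewrite ltn0.
Qed.

End counting_modulo_pi.

(** * Zeros of an antiperiodic function and of its radius of curvature *)

Section antiperiodic.
Context {R : realType}.
Local Notation pi := (@pi R).
Implicit Types f q : R -> R.

Definition antiperiodic f := forall t, f (t + pi) = - f t.

Definition zero_set f : set R := [set t | f t = 0].

Lemma zero_set_periodic f : antiperiodic f -> pi_periodic (zero_set f).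
Proof.
move=> af t; rewrite /zero_set /= af.
by split=> [/eqP|->]; rewrite ?oppr_eq0 ?oppr0 // => /eqP.
Qed.

Lemma antiperiodic_derive1 f : Cinf f -> antiperiodic f ->
  antiperiodic (derive1 f).
Proof.
move=> Cf af t; rewrite -(derive1_translate pi t Cf).
rewrite (_ : (fun y => f (y + pi)) = (fun y => - f y)); last exact/funext.
exact: is_derive1E (is_derive_opp (Cinf_is_derive Cf t)).
Qed.

Lemma zeros_mod_pi_finite f : continuous f -> simple_zeros f ->
  exists n, mod_pi (zero_set f) #= `I_n.
Proof. by move=> cf sf; apply/finite_setP; exact: finite_simple_zeros. Qed.

Lemma zeros_mod_pi_gt0 f n : continuous f -> antiperiodic f ->
  mod_pi (zero_set f) #= `I_n -> (0 < n)%N.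
Proof.
move=> cf af fn; have p0 := pi_gt0 R.
suff [t Ht] : mod_pi (zero_set f) !=set0.
  rewrite lt0n; apply/negP => /eqP n0; move: fn; rewrite n0 II0 card_eq0.
  by move=> /eqP e; move: Ht; rewrite e.
have [f0|/eqP f0] := pselect (f 0 = 0); first by exists 0; split => //; rewrite lexx.
have [|c /andP[c1 c2] fc] := @continuous_zero_between _ f 0 pi cf p0.
  have -> : f pi = - f 0 by rewrite -af add0r.
  rewrite mulrN oppr_lt0 -expr2.
  by rewrite exprn_even_gt0.
by exists c; split => //; rewrite ltW.
Qed.

(** One critical point between any two cyclically consecutive zeros. *)
Lemma rolle_mod_pi f (Z : set R) (n N : nat) (c : R) : Cinf f ->
  antiperiodic f -> pi_periodic Z ->
  mod_pi (zero_set f) #= `I_n -> mod_pi Z #= `I_N ->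
  (forall t, derive1 f t = 0 -> Z (t + c)) -> (n <= N)%N.
Proof.
move=> Cf af pZ fn ZN f'Z.
have n0 := zeros_mod_pi_gt0 (Cinf_continuous Cf) af fn.
have [z [fz zS zn _]] := mod_pi_enum (zero_set_periodic af) fn n0.
apply: (@mod_pi_card_ge _ Z n N (fun i => z i + c)) => // [i iln|]; last first.
  by rewrite -[X in z X]add0n zn; lra.
have [t /andP[t1 t2]] := mean_value (zS i) (Cinf_is_derive Cf).
rewrite (fz i) (fz i.+1) subrr => /esym/eqP; rewrite mulf_eq0 => /orP[/eqP f't|].
  by exists (t + c); [rewrite !ltrD2r t1|exact: f'Z].
by rewrite subr_eq0 gt_eqF.
Qed.

(** The radius of curvature of the envelope of the lines with support function
    [q]. *)
Definition radius_fun q (t : R) : R := q t + derive1 (derive1 q) t.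

Lemma Cinf_radius_fun q : Cinf q -> Cinf (radius_fun q).
Proof. by move=> Cq; apply: CinfD => //; do 2 apply: Cinf_derive1. Qed.

Lemma antiperiodic_radius_fun q : Cinf q -> antiperiodic q ->
  antiperiodic (radius_fun q).
Proof.
move=> Cq aq t; rewrite /radius_fun aq antiperiodic_derive1 ?opprD //.
  exact: Cinf_derive1.
exact: antiperiodic_derive1.
Qed.

(** The Wronskian of [sin (_ - a)] and [q], two functions that [1 + d^2/dt^2]
    sends to [0] and to [radius_fun q]. *)
Definition sturm_wronskian q (a t : R) : R :=
  derive1 q t * sin (t - a) - q t * cos (t - a).

Lemma is_derive_sturm_wronskian q (a t : R) : Cinf q ->
  is_derive t 1 (sturm_wronskian q a) (radius_fun q t * sin (t - a) : R).
Proof.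
move=> Cq.
have ds := is_derive_translate (is_derive_sin (t - a)).
have dc := is_derive_translate (is_derive_cos (t - a)).
have dW := is_derive_sub
  (is_derive_mul (Cinf_is_derive (Cinf_derive1 Cq) t) ds)
  (is_derive_mul (Cinf_is_derive Cq t) dc).
apply: is_derive_eq dW _.
by rewrite /radius_fun; ring.
Qed.

(** On an arch shorter than a half-turn the Wronskian goes from [0] to
    [q'(b) sin (b - a)], which has the sign of [q'(b)], opposite to that of [q]
    on the arch. *)
Lemma radius_fun_sign_on_arch q (a b : R) : Cinf q -> a < b -> b < a + pi ->
  q a = 0 -> q b = 0 -> derive1 q b != 0 ->
  exists2 c, a < c < b & 0 < radius_fun q c * derive1 q b.
Proof.
move=> Cq ab bpi qa qb q'b.
have [c /andP[c1 c2]] := mean_value ab (is_derive_sturm_wronskian a ^~ Cq).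
rewrite /sturm_wronskian qa qb !mul0r !subr0 subrr sin0 mulr0 subr0 => e.
exists c; first by rewrite c1.
have sb : 0 < sin (b - a) by apply: sin_gt0_pi; apply/andP; split; lra.
have sc : 0 < sin (c - a) by apply: sin_gt0_pi; apply/andP; split; lra.
have q2 : 0 < derive1 q b ^+ 2 by rewrite exprn_even_gt0.
have ba : 0 < b - a by lra.
have : 0 < derive1 q b ^+ 2 * sin (b - a) by rewrite mulr_gt0.
rewrite expr2 -mulrA e.
have -> : derive1 q b * (radius_fun q c * sin (c - a) * (b - a)) =
    (radius_fun q c * derive1 q b) * (sin (c - a) * (b - a)) by ring.
by rewrite pmulr_lgt0 // mulr_gt0.
Qed.

Lemma consecutive_derive1 f (z : nat -> R) i : Cinf f -> simple_zeros f ->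
  (forall i, f (z i) = 0) -> (forall i, z i < z i.+1) ->
  (forall i t, z i < t < z i.+1 -> f t <> 0) ->
  derive1 f (z i) * derive1 f (z i.+1) < 0.
Proof.
move=> Cf sf fz zS zc.
apply: (consecutive_zeros_derive (Cinf_continuous Cf) (zS i) (fz i) (fz i.+1)
  (zc i) (Cinf_is_derive Cf _) (Cinf_is_derive Cf _)).
- by apply/eqP; have [] := sf _ (fz i).
- by apply/eqP; have [] := sf _ (fz i.+1).
Qed.

Lemma alternate_signs (a b c d : R) : 0 < a * b -> 0 < c * d -> b * d < 0 ->
  a * c < 0.
Proof. by move=> ab cd; rewrite !ltNge; apply: contraNN => ac; nra. Qed.

(** With at least two zeros modulo [pi] all arches are shorter than a half-turn;
    [radius_fun q] takes opposite signs on neighbouring arches. *)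
Lemma zeros_le_zeros_radius_fun q (n N : nat) : Cinf q -> antiperiodic q ->
  simple_zeros q -> (1 < n)%N ->
  mod_pi (zero_set q) #= `I_n -> mod_pi (zero_set (radius_fun q)) #= `I_N ->
  (n <= N)%N.
Proof.
move=> Cq aq sq n1 qn rN.
have n0 := ltnW n1.
have Cr := Cinf_radius_fun Cq.
have ar := antiperiodic_radius_fun Cq aq.
have [z [qz zS zn zc]] := mod_pi_enum (zero_set_periodic aq) qn n0.
have z_le i j : (i <= j)%N -> z i <= z j.
  elim: j => [|j IH]; first by case: i.
  rewrite leq_eqVlt => /predU1P[-> //|]; rewrite ltnS => /IH.
  by have := zS j; lra.
have arch i : exists m, z i < m < z i.+1 /\
    0 < radius_fun q m * derive1 q (z i.+1).
  have zpi : z i.+1 < z i + pi.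
    rewrite -zn; apply: lt_le_trans (zS _) _; apply: z_le; lia.
  have [_ /eqP q'] := sq _ (qz i.+1).
  have [m ? ?] := radius_fun_sign_on_arch Cq (zS i) zpi (qz i) (qz i.+1) q'.
  by exists m.
have /choice[m Hm] := arch.
have alt i : derive1 q (z i) * derive1 q (z i.+1) < 0.
  exact: consecutive_derive1.
(* The last point is the first one shifted by [pi], so that the zeros found
   between these points stay in one period. *)
pose mm i := if (i < n)%N then m i else m 0%N + pi.
apply: (@mod_pi_card_ge _ _ n N mm (zero_set_periodic ar) rN) => [i iln|]; last first.
  by rewrite /mm ltnn n0.
rewrite /mm iln.
have [/andP[m1 m2] mi] := Hm i.
have a1 := alt i.+1.
case: ltnP => [Sin|nSi].
  have [/andP[m3 m4] mi'] := Hm i.+1.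
  have [||c c1 c2] := @continuous_zero_between _ _ (m i) (m i.+1) (Cinf_continuous Cr).
  - exact: lt_trans m3.
  - exact: alternate_signs mi mi' a1.
  by exists c.
have Si : i.+1 = n by lia.
have [/andP[m3 m4] m0] := Hm 0%N.
have zi : z i.+1 = z 0%N + pi by rewrite Si -[X in z X]add0n zn.
have q'i : derive1 q (z i.+1) = - derive1 q (z 0%N).
  by rewrite zi antiperiodic_derive1.
have a0 := alt 0%N.
have [||c c1 c2] := @continuous_zero_between _ _ (m i) (m 0%N + pi) (Cinf_continuous Cr).
- by rewrite (lt_trans m2) // zi ltrD2r.
- rewrite ar mulrN oppr_lt0.
  move: mi; rewrite q'i mulrN -mulNr => mi.
  by have := alternate_signs mi m0 a0; rewrite mulNr oppr_lt0.
by exists c.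
Qed.

(** Signs of the derivative alternate along the zeros and are reversed by the
    shift by [pi], so the number of zeros is odd; a single zero [c] is excluded
    because [(q + q'') sin (_ - c)] has mean zero over [[c, c + pi]]. *)
Lemma three_le_zeros_radius_fun q (N : nat) : Cinf q -> antiperiodic q ->
  simple_zeros (radius_fun q) -> mod_pi (zero_set (radius_fun q)) #= `I_N ->
  (3 <= N)%N.
Proof.
move=> Cq aq sr rN.
have Cr := Cinf_radius_fun Cq.
have ar := antiperiodic_radius_fun Cq aq.
have N0 := zeros_mod_pi_gt0 (Cinf_continuous Cr) ar rN.
have [z [rz zS zn zc]] := mod_pi_enum (zero_set_periodic ar) rN N0.
have alt i : derive1 (radius_fun q) (z i) * derive1 (radius_fun q) (z i.+1) < 0.
  exact: consecutive_derive1.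
have z0 := zn 0%N; rewrite add0n in z0.
have p0 := pi_gt0 R.
case: N N0 {rN zn} z0 => [//|[|[|//]]] _ z0.
  pose c := z 0%N.
  have cp : c < c + pi by lra.
  have [t /andP[t1 t2]] := mean_value cp (is_derive_sturm_wronskian c ^~ Cq).
  have -> : sturm_wronskian q c (c + pi) = - q c.
    by rewrite /sturm_wronskian aq addrAC subrr add0r sinpi cospi; ring.
  have -> : sturm_wronskian q c c = - q c.
    by rewrite /sturm_wronskian subrr sin0 cos0; ring.
  rewrite subrr => /esym/eqP.
  rewrite !mulf_eq0 => /orP[/orP[/eqP rt|]|].
  - by have := zc 0%N t; rewrite z0 t1 t2 => /(_ isT).
  - by rewrite gt_eqF // sin_gt0_pi //; apply/andP; split; lra.
  - by rewrite gt_eqF //; lra.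
have := alt 1%N; rewrite z0 antiperiodic_derive1 // mulrN oppr_lt0 mulrC => /ltW.
by rewrite leNgt alt.
Qed.

End antiperiodic.

(** * Continuous angles of rotating vectors *)

Section angle_lift.
Context {R : realType}.
Local Notation pi := (@pi R).

(** [A] is a continuous determination of the direction of [(v1, v2)], a
    diffeomorphism of the line with inverse [B]. *)
Record angle_lift (v1 v2 : R -> R) (P : R) (A B : R -> R) : Prop := AngleLift {
  lift_Cinf : Cinf A;
  lift_inv_Cinf : Cinf B;
  lift_derive_gt0 : forall t, 0 < derive1 A t;
  liftK : cancel A B;
  lift_invK : cancel B A;
  liftD : forall t, A (t + P) = A t + pi *+ 2;
  lift_direction : forall t, exists2 l, 0 < l &
    v1 t = l * cos (A t) /\ v2 t = l * sin (A t) }.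

Lemma lift_lt v1 v2 P A B : angle_lift v1 v2 P A B -> {mono A : x y / x < y}.
Proof.
move=> L; apply: derive_gt0_mono (lift_derive_gt0 L).
exact: Cinf_is_derive (lift_Cinf L).
Qed.

Lemma lift_inv_lt v1 v2 P A B : angle_lift v1 v2 P A B ->
  {mono B : x y / x < y}.
Proof. by move=> L x y; rewrite -(lift_lt L) !(lift_invK L). Qed.

Lemma lift_invD v1 v2 P A B : angle_lift v1 v2 P A B ->
  forall t, B (t + pi *+ 2) = B t + P.
Proof. by move=> L t; apply: (can_inj (liftK L)); rewrite (liftD L) !(lift_invK L). Qed.

Lemma lift_inv_derive_gt0 v1 v2 P A B : angle_lift v1 v2 P A B ->
  forall t, 0 < derive1 B t.
Proof.
move=> L t; have dB := Cinf_is_derive (lift_inv_Cinf L) t.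
have dAB := is_derive_chain (Cinf_is_derive (lift_Cinf L) (B t)) dB.
rewrite -(pmulr_rgt0 _ (lift_derive_gt0 L (B t))).
rewrite (_ : _ * _ = 1) //; apply: is_derive_uniq dAB _.
rewrite (_ : (fun _ => _) = id); last by apply/funext => y; rewrite (lift_invK L).
exact: is_derive_id.
Qed.

Section existence.
Context (v1 v2 : R -> R) (P : R) (P0 : 0 < P).
Context (Cv1 : Cinf v1) (Cv2 : Cinf v2).
Context (turn : forall t, 0 < v1 t * derive1 v2 t - v2 t * derive1 v1 t).
Context (per1 : forall t, v1 (t + P) = v1 t) (per2 : forall t, v2 (t + P) = v2 t).
Context (once : forall t s l : R, 0 < s < P -> 0 < l -> v1 (t + s) = l * v1 t ->
  v2 (t + s) <> l * v2 t).

Let N t := v1 t ^+ 2 + v2 t ^+ 2.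

Let N_gt0 t : 0 < N t.
Proof.
rewrite lt_def addr_ge0 ?sqr_ge0 // andbT; apply/eqP => Nt.
have /eqP : v1 t ^+ 2 + v2 t ^+ 2 = 0 by [].
rewrite paddr_eq0 ?sqr_ge0 // !sqrf_eq0 => /andP[/eqP h1 /eqP h2].
by have := turn t; rewrite h1 h2 !mul0r subrr ltxx.
Qed.

Let N_neq0 t : N t != 0. Proof. by rewrite gt_eqF. Qed.

Let Cinf_N : Cinf N.
Proof. by apply: CinfD; apply: CinfM. Qed.

(* the angular velocity of [(v1, v2)] *)
Let w t := (v1 t * derive1 v2 t - v2 t * derive1 v1 t) / N t.

Let w_gt0 t : 0 < w t. Proof. by rewrite divr_gt0. Qed.

Let Cinf_w : Cinf w.
Proof.
apply: (@CinfM _ _ (fun t => (N t)^-1)); last exact: CinfV Cinf_N.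
by apply: CinfB; apply: CinfM => //; exact: Cinf_derive1.
Qed.

Section direction.
Context (A : R -> R) (dA : forall t : R, is_derive t 1 A (w t)).
Context (l0 : R) (l0_gt0 : 0 < l0).
Context (e1 : v1 0 = l0 * cos (A 0)) (e2 : v2 0 = l0 * sin (A 0)).

Let T t := v2 t * cos (A t) - v1 t * sin (A t).
Let D t := v1 t * cos (A t) + v2 t * sin (A t).

(* The transversal part [T] of [v] in the moving frame satisfies a linear
   homogeneous equation with the same rate as the square root of [N]. *)
Let T_eq0 t : T t = 0.
Proof.
have dcos (x : R) := is_derive_chain (is_derive_cos (A x)) (dA x).
have dsin (x : R) := is_derive_chain (is_derive_sin (A x)) (dA x).
have d1 := Cinf_is_derive Cv1; have d2 := Cinf_is_derive Cv2.
have dT (x : R) := is_derive_sub (is_derive_mul (d2 x) (dcos x))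
                                 (is_derive_mul (d1 x) (dsin x)).
have dN (x : R) := is_derive_add (is_derive_mul (d1 x) (d1 x))
                                 (is_derive_mul (d2 x) (d2 x)).
have N0 x : v1 x * v1 x + v2 x * v2 x != 0 by rewrite -!expr2; exact: N_neq0.
have dG (x : R) := is_derive_mul (is_derive_mul (dT x) (dT x))
  (@is_derive_inv _ (fun y => v1 y * v1 y + v2 y * v2 y) _ _ (N0 x) (dN x)).
pose G x := T x * T x * (v1 x * v1 x + v2 x * v2 x)^-1.
have dG0 (x : R) : is_derive x 1 G 0.
  apply: is_derive_eq (dG x) _.
  have := N0 x; rewrite /w /N.
  move: (cos (A x)) (sin (A x)) (v1 x) (v2 x) (derive1 v1 x) (derive1 v2 x).
  move=> c s a b a' b' n0; field.
  by [].
have := is_derive_0_is_cst t 0 dG0; rewrite /G.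
have -> : T 0 = 0 by rewrite /T e1 e2; ring.
rewrite !mul0r => /eqP; rewrite mulf_eq0 invr_eq0 (negPf (N0 t)) orbF.
by rewrite mulf_eq0 orbb => /eqP.
Qed.

Let cos2sin2 t : cos (A t) * cos (A t) + sin (A t) * sin (A t) = 1.
Proof. by rewrite -!expr2 cos2Dsin2. Qed.

Let v1E t : v1 t = D t * cos (A t).
Proof.
have -> : D t * cos (A t) = v1 t * (cos (A t) * cos (A t) + sin (A t) * sin (A t))
    + sin (A t) * T t by rewrite /D /T; ring.
by rewrite T_eq0 cos2sin2 mulr0 addr0 mulr1.
Qed.

Let v2E t : v2 t = D t * sin (A t).
Proof.
have -> : D t * sin (A t) = v2 t * (cos (A t) * cos (A t) + sin (A t) * sin (A t))
    - cos (A t) * T t by rewrite /D /T; ring.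
by rewrite T_eq0 cos2sin2 mulr0 subr0 mulr1.
Qed.

Let D_gt0 t : 0 < D t.
Proof.
have Dn0 x : D x <> 0.
  by move=> Dx; have := N_gt0 x; rewrite /N v1E v2E Dx !mul0r expr0n addr0 ltxx.
have D0 : 0 < D 0.
  have -> : D 0 = l0 * (cos (A 0) * cos (A 0) + sin (A 0) * sin (A 0)).
    by rewrite /D e1 e2; ring.
  by rewrite cos2sin2 mulr1.
have cD : continuous D.
  have CA : Cinf A by exact: Cinf_primitive dA Cinf_w.
  apply: Cinf_continuous; apply: CinfD; apply: CinfM => //.
    exact: Cinf_cos.
  exact: Cinf_sin.
case: (ltgtP t 0) => [t0|t0|->//]; rewrite ltNge le_eqVlt; apply/negP.
  case/predU1P => [/Dn0//|Dt].
  have [|c _ /Dn0//] := continuous_zero_between cD t0.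
  by rewrite pmulr_llt0.
case/predU1P => [/Dn0//|Dt].
have [|c _ /Dn0//] := continuous_zero_between cD t0.
by rewrite pmulr_rlt0.
Qed.

Lemma lift_direction_exists t : exists2 l, 0 < l &
  v1 t = l * cos (A t) /\ v2 t = l * sin (A t).
Proof. by exists (D t); [exact: D_gt0|split; [exact: v1E|exact: v2E]]. Qed.

End direction.

(** The angle is a primitive of the angular velocity. Its increase over a period
    is a positive multiple of [2 pi], and not more than [2 pi] since otherwise a
    direction would come back within the period. *)
Lemma angle_lift_exists : exists A B, angle_lift v1 v2 P A B.
Proof.
have [F dF] := continuous_has_primitive (Cinf_continuous Cinf_w).
have [a0 [l0 [l0p e1 e2]]] := polar_angle (N_gt0 0).
pose A t := F t + (a0 - F 0).
have dA (t : R) : is_derive t 1 A (w t).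
  have := is_derive_add (dF t) (is_derive_const (a0 - F 0) t).
  by rewrite addr0.
have A0 : A 0 = a0 by rewrite /A addrC subrK.
rewrite -A0 in e1 e2.
have dir := lift_direction_exists dA l0p e1 e2.
have CA : Cinf A by exact: Cinf_primitive dA Cinf_w.
have A'E t : derive1 A t = w t by exact: is_derive1E (dA t).
have ltA : {mono A : x y / x < y} by exact: derive_gt0_mono dA w_gt0.
have AP t : A (t + P) = A t + (A P - A 0).
  have wP x : w (x + P) = w x.
    by rewrite /w /N !derive1_periodic // per1 per2.
  have d0 (x : R) : is_derive x 1 (fun y => A (y + P) - A y) 0.
    have := is_derive_sub (is_derive_translate (dA (x + P))) (dA x).
    by rewrite wP subrr.
  have := is_derive_0_is_cst t 0 d0; rewrite /= add0r => e.
  by rewrite -e [RHS]addrC subrK.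
have d0 : 0 < A P - A 0 by rewrite subr_gt0 ltA.
have d2pi : pi *+ 2 <= A P - A 0.
  apply: cos_eq1_ge2pi => //.
  have [l lp [f1 f2]] := dir 0; have [m mp [g1 g2]] := dir P.
  have := per1 0; have := per2 0; rewrite add0r f1 f2 g1 g2 => h2 h1.
  rewrite cosB.
  have := cos2Dsin2 (A P); have := cos2Dsin2 (A 0).
  move: (cos (A P)) (sin (A P)) (cos (A 0)) (sin (A 0)) h1 h2 => c s c' s' h1 h2 k1 k2.
  have ml : m = l.
    have : m ^+ 2 = l ^+ 2.
      have <- : (m * c) ^+ 2 + (m * s) ^+ 2 = m ^+ 2.
        by rewrite !exprMn -mulrDr k2 mulr1.
      by rewrite h1 h2 !exprMn -mulrDr k1 mulr1.
    by move/eqP; rewrite eqrXn2 ?ltW // => /eqP.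
  move: h1 h2; rewrite ml => /(mulfI (lt0r_neq0 lp)) -> /(mulfI (lt0r_neq0 lp)) ->.
  by rewrite -!expr2.
(* A larger increase would bring back the direction of [v 0] before time [P]. *)
have AP2 : A P - A 0 = pi *+ 2.
  apply/eqP; rewrite eq_le d2pi andbT leNgt; apply/negP => lt2.
  have p0 : 0 < pi *+ 2 by rewrite mulrn_wgt0 // pi_gt0.
  have [||s s01 As] := @continuous_zero_between _ (fun x => A x - (A 0 + pi *+ 2)) 0 P _ P0.
  - by apply: Cinf_continuous; apply: CinfB => //; exact: Cinf_cst.
  - rewrite nmulr_rlt0; first by rewrite opprD addrA subr_gt0.
    by rewrite opprD addrA subrr sub0r oppr_lt0.
  have {}As : A s = A 0 + pi *+ 2 by apply/eqP; rewrite -subr_eq0 As.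
  have [l lp [f1 f2]] := dir 0; have [m mp [g1 g2]] := dir s.
  apply: (@once 0 s (m / l) s01); rewrite ?divr_gt0 // add0r.
    by rewrite g1 f1 As cosD2pi mulrA divfK // gt_eqF.
  by rewrite g2 f2 As sinD2pi mulrA divfK // gt_eqF.
have {}AP t : A (t + P) = A t + pi *+ 2 by rewrite AP AP2.
have APn (n : nat) t : A (t + P *+ n) = A t + pi *+ 2 *+ n.
  elim: n => [|n IH]; first by rewrite !mulr0n !addr0.
  by rewrite [P *+ _]mulrSr addrA AP IH -addrA; congr (_ + _); rewrite -(mulrSr (pi *+ 2)).
have surj y : exists t, A t = y.
  have p0 : 0 < pi *+ 2 by rewrite mulrn_wgt0 // pi_gt0.
  have [n Hn] : exists n : nat, `|y - A 0| < (pi *+ 2) *+ n.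
    exists (Num.truncn (`|y - A 0| / (pi *+ 2))).+1.
    by rewrite -mulr_natr mulrC -ltr_pdivrMr // truncnS_gt.
  have h1 : A (P *+ n) = A 0 + pi *+ 2 *+ n by rewrite -APn add0r.
  have h2 : A (- (P *+ n)) = A 0 - pi *+ 2 *+ n.
    have := APn n (- (P *+ n)); rewrite addrC subrr => ->.
    by rewrite addrK.
  move: Hn; rewrite ltr_norml => /andP[Hn1 Hn2].
  have n0 : - (P *+ n) < P *+ n by rewrite -ltA h1 h2; lra.
  have [||t _ At] := @continuous_zero_between _ (fun x => A x - y) _ _ _ n0.
  - by apply: Cinf_continuous; apply: CinfB => //; exact: Cinf_cst.
  - by rewrite h1 h2 nmulr_rlt0; lra.
  by exists t; apply/eqP; rewrite -subr_eq0 At.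
have [B BK] := choice surj.
have AK : cancel A B.
  move=> t; apply/eqP; case: ltgtP (BK (A t)) => // [h|h] e.
    by move: h; rewrite -ltA e ltxx.
  by move: h; rewrite -ltA e ltxx.
exists A, B; split => //.
- by apply: Cinf_inverse CA _ AK BK => t; rewrite A'E gt_eqF.
- by move=> t; rewrite A'E.
Qed.

End existence.
End angle_lift.

(** * Vectors, lines and rays in the plane *)

Section plane_algebra.
Context {R : realType}.
Implicit Types x y z : R * R.

Lemma fstB x y : (x - y).1 = x.1 - y.1. Proof. by []. Qed.
Lemma sndB x y : (x - y).2 = x.2 - y.2. Proof. by []. Qed.
Lemma fstD x y : (x + y).1 = x.1 + y.1. Proof. by []. Qed.
Lemma sndD x y : (x + y).2 = x.2 + y.2. Proof. by []. Qed.
Lemma fstZ (a : R) x : (a *: x).1 = a * x.1. Proof. by []. Qed.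
Lemma sndZ (a : R) x : (a *: x).2 = a * x.2. Proof. by []. Qed.

Lemma fstN x : (- x).1 = - x.1. Proof. by []. Qed.
Lemma sndN x : (- x).2 = - x.2. Proof. by []. Qed.

Lemma plane_ext x y : x.1 = y.1 -> x.2 = y.2 -> x = y.
Proof. by case: x y => [a b] [c d] /= -> ->. Qed.

Definition coordE := (fstB, sndB, fstN, sndN, fstD, sndD, fstZ, sndZ).

Lemma dotD (x y z : R * R) : dot x (y + z) = dot x y + dot x z.
Proof. by rewrite /dot !coordE; ring. Qed.

Lemma dotZ (x y : R * R) (k : R) : dot x (k *: y) = k * dot x y.
Proof. by rewrite /dot !coordE; ring. Qed.

Lemma dotN (x y : R * R) : dot x (- y) = - dot x y.
Proof. by rewrite /dot !coordE; ring. Qed.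

Lemma nvec_dot (a : R) : dot (nvec a) (nvec a) = 1.
Proof. by rewrite /dot /nvec /= -!expr2 cos2Dsin2. Qed.

Lemma dot_nvecE (a : R) (x : R * R) : dot (nvec a) x = x.1 * cos a + x.2 * sin a.
Proof. by rewrite /dot /nvec /=; ring. Qed.

Lemma cross_eq0_collinear (x y z : R * R) : x <> y ->
  cross (y - x) (z - x) = 0 -> exists k : R, z - x = k *: (y - x).
Proof.
move=> xy; have : y - x != 0 by rewrite subr_eq0; apply/eqP => /esym.
move: (y - x) (z - x) => [a b] [c d] ab0; rewrite /cross /= => e.
have n0 : a * a + b * b != 0.
  apply: contra ab0; rewrite paddr_eq0 -?expr2 ?sqr_ge0 // !sqrf_eq0.
  by move=> /andP[/eqP -> /eqP ->].
exists ((a * c + b * d) / (a * a + b * b)).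
congr (_, _); rewrite ?fstZ ?sndZ /=; apply: (mulIf n0).
  rewrite mulrAC divfK //.
  apply: subr0_eq; rewrite (_ : _ - _ = - b * (a * d - b * c)); last by ring.
  by rewrite e mulr0.
rewrite mulrAC divfK //.
apply: subr0_eq; rewrite (_ : _ - _ = a * (a * d - b * c)); last by ring.
by rewrite e mulr0.
Qed.

Lemma crossZ (k : R) (x y : R * R) : cross (k *: x) y = k * cross x y.
Proof. by rewrite /cross !coordE; ring. Qed.

Lemma crossZr (k : R) (x y : R * R) : cross x (k *: y) = k * cross x y.
Proof. by rewrite /cross !coordE; ring. Qed.

End plane_algebra.

Section directions.
Context {R : realType}.
Local Notation pi := (@pi R).

Lemma nvecDpi (a : R) : nvec (a + pi) = - nvec a.
Proof. by rewrite /nvec cosDpi sinDpi. Qed.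

Lemma dot_nvec_tvec (a b : R) : dot (nvec a) (tvec b) = sin (a - b).
Proof. by rewrite /dot /nvec /tvec /= sinB; ring. Qed.

Lemma cross_nvec (a b : R) : cross (nvec a) (nvec b) = sin (b - a).
Proof. by rewrite /cross /nvec /= sinB; ring. Qed.

Lemma cross_tvec (a : R) (x : R * R) : cross (tvec a) x = - dot (nvec a) x.
Proof. by rewrite /cross /dot /nvec /tvec /=; ring. Qed.

Lemma nvecDpihalf (a : R) : nvec (a + pi / 2) = tvec a.
Proof. by rewrite /nvec /tvec cosDpihalf sinDpihalf. Qed.

Lemma tvecDpihalf (a : R) : tvec (a + pi / 2) = - nvec a.
Proof. by rewrite /nvec /tvec cosDpihalf sinDpihalf. Qed.

Lemma line_through_normal (x y : R * R) (a k : R) : k != 0 ->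
  y - x = k *: tvec a ->
  line_through x y = line_normal x a 0.
Proof.
move=> k0 e; apply/seteqP; split => z; rewrite /line_through /line_normal /= e crossZ cross_tvec.
  by move=> /eqP; rewrite mulf_eq0 (negPf k0) /= oppr_eq0 => /eqP.
by move=> ->; rewrite oppr0 mulr0.
Qed.

Lemma line_normal_base (p q : R * R) (a c : R) :
  line_normal q a c = line_normal p a (c + dot (nvec a) (q - p)).
Proof.
apply/seteqP; split => z; rewrite /line_normal /=.
  by move=> <-; rewrite -dotD addrA subrK.
move=> e; apply: (addIr (dot (nvec a) (q - p))).
by rewrite -e -dotD addrA subrK.
Qed.

Lemma line_normalDpi (p : R * R) (a c : R) :
  line_normal p (a + pi) c = line_normal p a (- c).
Proof.
have e z : dot (nvec (a + pi)) z = - dot (nvec a) z.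
  by rewrite nvecDpi /dot !coordE; ring.
apply/seteqP; split => z; rewrite /line_normal /= e.
  by move=> <-; rewrite opprK.
by move=> ->; rewrite opprK.
Qed.

Lemma line_normal_eq (p : R * R) (a b c d : R) :
  line_normal p a c = line_normal p b d -> sin (b - a) = 0.
Proof.
move=> e.
have h1 : line_normal p b d (p + c *: nvec a).
  by rewrite -e /line_normal /= addrC addKr dotZ nvec_dot mulr1.
have h2 : line_normal p b d (p + (c *: nvec a + tvec a)).
  rewrite -e /line_normal /= addrC addKr dotD dotZ nvec_dot mulr1.
  by rewrite dot_nvec_tvec subrr sin0 addr0.
move: h1 h2; rewrite /line_normal /= ![p + _]addrC !addrK dotD dot_nvec_tvec => ->.
by move=> /eqP; rewrite -subr_eq0 addrAC subrr add0r => /eqP.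
Qed.

Lemma line_throughC (x y : R * R) : line_through x y = line_through y x.
Proof.
apply/seteqP; split=> z; rewrite /line_through /cross /= => e.
  by rewrite -[RHS]oppr0 -[in RHS]e ?coordE; ring.
by rewrite -[RHS]oppr0 -[in RHS]e ?coordE; ring.
Qed.

Lemma line_through_left (x y : R * R) : line_through x y x.
Proof. by rewrite /line_through /= subrr /cross /= !mulr0 subrr. Qed.

Lemma line_through_right (x y : R * R) : line_through x y y.
Proof. by rewrite line_throughC; exact: line_through_left. Qed.

End directions.

Section rays.
Context {R : realType}.

(** Inside [A] the ray would be an unbounded connected set containing [p]. *)
Lemma ray_meets (A : set (R * R)) (p u : R * R) : A p -> u <> 0 ->
  bounded_set (connected_component A p) ->
  exists2 s, 0 <= s & ~ A (p + s *: u).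
Proof.
move=> Ap u0 [M [Mr HM]]; apply: contrapT => H.
pose ray (s : R) : R * R := p + s *: u.
have sub : ray @` `[0, +oo[ `<=` connected_component A p.
  apply: connected_component_max.
  - by exists 0; [rewrite /= in_itv /= lexx|rewrite /ray scale0r addr0].
  - move=> _ [s /= + <-]; rewrite in_itv /= andbT => s0.
    by apply: contrapT => nA; apply: H; exists s.
  - apply: connected_continuous_connected.
      by apply/connected_intervalP; exact: interval_is_interval.
    apply: continuous_subspaceT => s; rewrite /ray.
    by apply: cvgD; [exact: cvg_cst|apply: cvgZ; [exact: cvg_id|exact: cvg_cst]].
have un : 0 < `|u| by rewrite normr_gt0; apply/eqP.
pose s := (`|M| + 2 + `|p|) / `|u|.
have s0 : 0 <= s by rewrite divr_ge0 // ?addr_ge0.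
have := HM (`|M| + 1) _ (ray s) _.
rewrite ltr_pwDr ?ler_norm // => /(_ isT) Hs.
have {}Hs : `|ray s| <= `|M| + 1.
  by apply: Hs; apply: sub; exists s => //=; rewrite in_itv /= s0.
have : `|s *: u| <= `|ray s| + `|p|.
  rewrite (_ : s *: u = ray s - p); first exact: ler_normB.
  by rewrite /ray addrC addKr.
rewrite normrZ (ger0_norm s0) divfK ?gt_eqF //; lra.
Qed.

End rays.

(** * The oval parametrized by its normal angle *)

Section normal_angle.
Context {R : realType} (C : oval R).
Local Notation pi := (@pi R).

(** The point [g a] is the one with outward normal [nvec a]: tangents are parallel
    when the normals agree up to sign, so that [iota_oval] becomes the shift by
    [pi]. *)
Record normal_angle_param (g : R -> R * R) : Prop := NormalAngleParam {
  nap_Cinf1 : Cinf (fun a => (g a).1);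
  nap_Cinf2 : Cinf (fun a => (g a).2);
  nap_periodic : forall a, g (a + pi *+ 2) = g a;
  nap_velocity : forall a, exists2 k, 0 < k &
    derive1 (fun a => (g a).1) a = - (k * sin a) /\
    derive1 (fun a => (g a).2) a = k * cos a;
  nap_convex : forall a b, g b <> g a -> dot (nvec a) (g b - g a) < 0;
  nap_inj : forall a b, a < b < a + pi *+ 2 -> g b <> g a;
  nap_range : range g = oval_curve C;
  nap_iota : forall a, iota_oval C (g a) = g (a + pi) }.

Lemma oval_eq_mod (s t : R) : C s = C t -> exists k : int, s = t + period C * k%:~R.
Proof.
move=> st.
have [k hk] := reduce_modulo s (period_gt0 C).
have [m hm] := reduce_modulo t (period_gt0 C).
have := param_simple hk hm.
rewrite !(periodic_int _ _ (@param_periodic _ C)) => /(_ st) e.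
exists (m - k); rewrite intrD rmorphN /=.
by rewrite mulrDr addrA -e; ring.
Qed.

Lemma oval_neq (s t : R) : s < t < s + period C -> C t <> C s.
Proof.
move=> /andP[st tsP] /oval_eq_mod[k e].
have P0 := period_gt0 C.
have k0 : 0 < k%:~R :> R by nra.
have k1 : k%:~R < 1%:~R :> R by rewrite /=; nra.
move: k0 k1; rewrite -[0]/(0%:~R) !ltr_int; lia.
Qed.

(** With parallel tangents of the same orientation, each of the two points would
    lie strictly to the left of the tangent at the other one. *)
Lemma oval_tangents_neq (s t m : R) : C s <> C t -> 0 < m ->
  (velocity C s).1 = m * (velocity C t).1 ->
  (velocity C s).2 <> m * (velocity C t).2.
Proof.
move=> st m0 e1 e2.
have := @strictly_convex _ C s t st.
have := @strictly_convex _ C t s (nesym st).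
rewrite /cross e1 e2 !coordE.
move: (velocity C t).1 (velocity C t).2 (C s).1 (C s).2 (C t).1 (C t).2.
move=> x y a b c d h1 h2.
have : 0 < m * (x * (d - b) - y * (c - a)) by rewrite mulrBr !mulrA.
by rewrite pmulr_rgt0 // => h3; move: h2 h3 {st e1 e2} => h2 h3; lra.
Qed.

(** The outward normal is the velocity turned by a right angle; it rotates
    counterclockwise since the curvature is positive, and convexity prevents it
    from taking a direction twice. *)
Lemma normal_angle_param_exists : exists g, normal_angle_param g.
Proof.
pose c1 t := (C t).1; pose c2 t := (C t).2.
have [/smoothP Cc1 /smoothP Cc2] := param_smooth C.
pose v1 := derive1 c2; pose v2 := fun t => - derive1 c1 t.
have Cv1 : Cinf v1 by exact: Cinf_derive1.
have Cv2 : Cinf v2 by apply: CinfN; exact: Cinf_derive1.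
have dv2 t : derive1 v2 t = - derive1 (derive1 c1) t.
  apply: is_derive1E; apply: is_derive_opp.
  exact: Cinf_is_derive (Cinf_derive1 Cc1) t.
have turn t : 0 < v1 t * derive1 v2 t - v2 t * derive1 v1 t.
  have := curvature_gt0 C t; rewrite /curvature.
  have -> : cross (velocity C t) (acceleration C t) =
      v1 t * derive1 v2 t - v2 t * derive1 v1 t.
    rewrite dv2 mulrN mulNr opprK addrC.
    by [].
  move=> kpos; rewrite ltNge; apply/negP => neg.
  by move: kpos; rewrite ltNge mulr_le0_ge0.
have per1 t : v1 (t + period C) = v1 t.
  by apply: derive1_periodic => // x; rewrite /c2 param_periodic.
have per2 t : v2 (t + period C) = v2 t.
  by rewrite /v2 derive1_periodic // => x; rewrite /c1 param_periodic.
have once (t s l : R) : 0 < s < period C -> 0 < l -> v1 (t + s) = l * v1 t ->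
    v2 (t + s) <> l * v2 t.
  move=> /andP[s0 sP] l0 e1; rewrite /v2 mulrN => /oppr_inj e2.
  apply: (@oval_tangents_neq (t + s) t l) => //.
  by apply: oval_neq; rewrite ltrDl s0 ltrD2l.
(* [A t] is the normal angle at [C t]. *)
have [A [B L]] := angle_lift_exists (period_gt0 C) Cv1 Cv2 turn per1 per2 once.
pose g a := C (B a).
have C1 : Cinf (fun a => (g a).1) by exact: (Cinf_comp Cc1 (lift_inv_Cinf L)).
have C2 : Cinf (fun a => (g a).2) by exact: (Cinf_comp Cc2 (lift_inv_Cinf L)).
have P0 := period_gt0 C.
have dirB a : exists2 l, 0 < l & derive1 c1 (B a) = - (l * sin a) /\
    derive1 c2 (B a) = l * cos a.
  have [l l0 [e1 e2]] := lift_direction L (B a).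
  rewrite (lift_invK L) in e1 e2.
  by exists l => //; split => //; rewrite -e2 opprK.
have gper a : g (a + pi *+ 2) = g a.
  by rewrite /g (lift_invD L) param_periodic.
have convex a b : g b <> g a -> dot (nvec a) (g b - g a) < 0.
  move=> ab; have := strictly_convex ab.
  have [l l0 [e1 e2]] := dirB a.
  have {}e1 : (velocity C (B a)).1 = - (l * sin a) by exact: e1.
  have {}e2 : (velocity C (B a)).2 = l * cos a by exact: e2.
  rewrite -/(g a) -/(g b) /cross e1 e2 /dot; move: (g b - g a) => [x y] /=.
  rewrite (_ : _ - _ = - l * (cos a * x + sin a * y)); last by ring.
  by rewrite mulNr oppr_gt0 pmulr_rlt0.
have inj a b : a < b < a + pi *+ 2 -> g b <> g a.
  move=> /andP[ab ba]; apply: oval_neq.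
  by rewrite (lift_inv_lt L) ab -(lift_invD L) (lift_inv_lt L).
have rg : range g = oval_curve C.
  apply/seteqP; split=> _ [t _ <-]; first by exists (B t).
  by exists (A t) => //; rewrite /g (liftK L).
exists g; split => //.
- move=> a; have [l l0 [e1 e2]] := dirB a.
  have dB := Cinf_is_derive (lift_inv_Cinf L) a.
  have B0 := lift_inv_derive_gt0 L a.
  exists (l * derive1 B a); first by rewrite mulr_gt0.
  split.
    rewrite (is_derive1E (is_derive_chain (Cinf_is_derive Cc1 (B a)) dB)).
    by rewrite -[derive1 _ _]/(derive1 c1 (B a)) e1; ring.
  rewrite (is_derive1E (is_derive_chain (Cinf_is_derive Cc2 (B a)) dB)).
  by rewrite -[derive1 _ _]/(derive1 c2 (B a)) e2; ring.
move=> a.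
have p0 := pi_gt0 R.
have gpi : g (a + pi) <> g a.
  by apply: inj; rewrite ltrDl p0 ltrD2l mulr2n ltrDl.
have crossE s t : exists2 m, 0 < m &
    cross (velocity C s) (velocity C t) = m * sin (A t - A s).
  have [l l0 [e1 e2]] := dirB (A s); have [m m0 [f1 f2]] := dirB (A t).
  exists (l * m); first by rewrite mulr_gt0.
  rewrite !(liftK L) in e1 e2 f1 f2.
  have -> : cross (velocity C s) (velocity C t) =
    derive1 c1 s * derive1 c2 t - derive1 c2 s * derive1 c1 t by [].
  by rewrite e1 e2 f1 f2 sinB; ring.
apply: xget_unique.
  split; [by rewrite -rg; exists (a + pi)|by []|].
  exists (B a), (B (a + pi)); split => //.
  have [m _ ->] := crossE (B a) (B (a + pi)).
  by rewrite !(lift_invK L) addrAC subrr add0r sinpi mulr0.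
move=> y [_ yx [s [t [Cs Ct]]]].
have [m m0 ->] := crossE s t.
move/eqP; rewrite mulf_eq0 gt_eqF //= => /eqP sAA.
have [k hk] := reduce_modulo (A t - A s) two_pi_gt0.
have gA u : g (A u) = C u by rewrite /g (liftK L).
have As : exists j : int, A s = a + pi *+ 2 * j%:~R.
  have [j] := @oval_eq_mod s (B a) Cs.
  have hB (u : R) : A (u + period C * j%:~R) = A u + pi *+ 2 * j%:~R.
    have := @periodic_int R _ (fun u => A u - pi *+ 2 * (u / period C)) (period C) j u.
    have hper x : A (x + period C) - pi *+ 2 * ((x + period C) / period C) =
        A x - pi *+ 2 * (x / period C).
      have -> : (x + period C) / period C = x / period C + 1.
        by rewrite mulrDl divff // gt_eqF.
      by rewrite (liftD L); ring.
    move=> /(_ hper) e.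
    apply: (addIr (- (pi *+ 2 * (u / period C)))); rewrite -[RHS]addrAC -e.
    have -> : (u + period C * j%:~R) / period C = u / period C + j%:~R.
      by rewrite mulrDl [period C * _]mulrC mulfK // gt_eqF.
    by ring.
  by move=> ->; exists j; rewrite hB (lift_invK L).
have [j Aj] := As.
have ytE : y = g (a + ((A t - A s) + pi *+ 2 * k%:~R)).
  rewrite -Ct -gA -(periodic_int (k - j) (A t) gper); congr g.
  by rewrite Aj intrD rmorphN /=; ring.
have s0 : sin (A t - A s + pi *+ 2 * k%:~R) = 0.
  by rewrite (periodic_int k _ (@sinD2pi R)).
have [d0|dpi] := sin_eq0_in hk s0.
  by case: yx; rewrite ytE d0 addr0 -Cs; rewrite -gA Aj (periodic_int j a gper).
by rewrite ytE dpi.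
Qed.

End normal_angle.

(** * Convexity and the position of an interior point *)

Section chords.
Context {R : realType} (C : oval R) (g : R -> R * R).
Context (G : normal_angle_param C g).
Local Notation pi := (@pi R).

(** Of three collinear points one lies between the two others, which its tangent
    cannot leave strictly on the same side. *)
Lemma not_collinear (a b c : R) : g a <> g b -> g b <> g c -> g c <> g a ->
  cross (g b - g a) (g c - g a) <> 0.
Proof.
move=> ab bc ca /(cross_eq0_collinear ab)[k ck].
have cE : g c = g a + k *: (g b - g a) by rewrite -ck addrC subrK.
have h1 := nap_convex G (nesym ab).
have h2 := nap_convex G ca; rewrite ck dotZ in h2.
have k0 : 0 < k by nra.
have h3 := nap_convex G ab.
have h4 := nap_convex G (nesym bc).
have e4 : g c - g b = (1 - k) *: (g a - g b).
  by apply: plane_ext; rewrite cE !coordE; ring.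
rewrite e4 dotZ in h4.
have k1 : k < 1 by nra.
have h5 := nap_convex G (nesym ca); have h6 := nap_convex G bc.
have e5 : g a - g c = - k *: (g b - g a).
  by apply: plane_ext; rewrite cE !coordE; ring.
have e6 : g b - g c = (1 - k) *: (g b - g a).
  by apply: plane_ext; rewrite cE !coordE; ring.
rewrite e5 dotZ mulNr oppr_lt0 pmulr_rgt0 // in h5.
by rewrite e6 dotZ pmulr_rlt0 ?subr_gt0 // ltNge (ltW h5) in h6.
Qed.

(** As a function of [c], the cross product vanishes at [c = b] with positive
    derivative, and [not_collinear] excludes any later zero before
    [a + 2 pi]. *)
Lemma orientation (a b c : R) : a < b -> b < c -> c < a + pi *+ 2 ->
  0 < cross (g b - g a) (g c - g a).
Proof.
move=> ab bc ca.
have gab : g b <> g a by apply: (nap_inj G); rewrite ab (lt_trans bc).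
pose w := g b - g a.
pose F s := w.1 * ((g s).2 - (g a).2) - w.2 * ((g s).1 - (g a).1).
have [k k0 [e1 e2]] := nap_velocity G b.
have CF : Cinf F.
  by apply: CinfB; apply: CinfM; try exact: Cinf_cst;
    apply: CinfB; try exact: Cinf_cst; [exact: nap_Cinf2 G|exact: nap_Cinf1 G].
have dF : is_derive b 1 F (k * dot (nvec b) w).
  have d1 := is_derive_sub (Cinf_is_derive (nap_Cinf1 G) b) (is_derive_const (g a).1 b).
  have d2 := is_derive_sub (Cinf_is_derive (nap_Cinf2 G) b) (is_derive_const (g a).2 b).
  have dd := is_derive_sub (is_derive_mul (is_derive_const w.1 b) d2)
                           (is_derive_mul (is_derive_const w.2 b) d1).
  apply: is_derive_eq dd _.
  by rewrite e1 e2 dot_nvecE; ring.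
have Fb : F b = 0 by rewrite /F /w !coordE; ring.
have d0 : 0 < k * dot (nvec b) w.
  rewrite pmulr_rgt0 // /w -[g b - g a]opprB dotN oppr_gt0.
  exact: (nap_convex G (nesym gab)).
have [e e0 He] := simple_zero_sign dF Fb (lt0r_neq0 d0).
pose t := b + Num.min e (c - b) / 2.
have m0 : 0 < Num.min e (c - b) by rewrite lt_min e0 subr_gt0.
have me : Num.min e (c - b) <= e by rewrite ge_min lexx.
have mc : Num.min e (c - b) <= c - b by rewrite ge_min lexx orbT.
have bt : b < t by rewrite ltrDl divr_gt0.
have tc : t < c by rewrite /t; lra.
have Ft : 0 < F t.
  have tb : t - b = Num.min e (c - b) / 2 by rewrite /t addrC addKr.
  have tb0 : 0 < t - b by rewrite subr_gt0.
  have te : t - b < e by rewrite tb; lra.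
  have := He t (negbT (gt_eqF bt)); rewrite (gtr0_norm tb0) => /(_ te).
  by rewrite (pmulr_lgt0 _ tb0) (pmulr_lgt0 _ d0).
rewrite -[cross _ _]/(F c) ltNge le_eqVlt; apply/negP => /predU1P[Fc|Fc].
  apply: (@not_collinear a b c) Fc => //; first exact: nesym.
    by apply/nesym/(nap_inj G); rewrite bc (lt_trans ca) // ltrD2r.
  by apply: (nap_inj G); rewrite (lt_trans ab bc).
have [|s /andP[ts sc] Fs] := continuous_zero_between (Cinf_continuous CF) tc.
  by rewrite pmulr_rlt0.
have bs := lt_trans bt ts; have sa := lt_trans sc ca.
apply: (@not_collinear a b s) Fs => //; first exact: nesym.
  by apply/nesym/(nap_inj G); rewrite bs (lt_trans sa) // ltrD2r.
by apply: (nap_inj G); rewrite (lt_trans ab bs).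
Qed.

Section interior.
Context (p : R * R) (p_int : oval_int C p).

(** Otherwise the ray from [p] in the direction of the outward normal stays beyond
    the tangent line at [g a] and misses the oval. *)
Lemma interior_inside (a : R) : dot (nvec a) (p - g a) < 0.
Proof.
have [pC bC] := p_int.
rewrite ltNge; apply/negP => h.
have n0 : nvec a <> 0.
  by move=> n0; have := nvec_dot a; rewrite n0 /dot /= !mul0r addr0 => /esym/eqP; rewrite oner_eq0.
have [s s0 ns] := @ray_meets _ _ p (nvec a) pC n0 bC.
have {ns} : oval_curve C (p + s *: nvec a) by exact: contrapT.
rewrite -(nap_range G) => -[b _ gb].
have db : dot (nvec a) (g b - g a) = s + dot (nvec a) (p - g a).
  have -> : g b - g a = s *: nvec a + (p - g a) by rewrite gb -addrA addrCA.
  by rewrite (dotD _ (s *: _)) dotZ nvec_dot mulr1.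
have [e|ne] := pselect (g b = g a).
  have : s + dot (nvec a) (p - g a) = 0.
    by rewrite -db e subrr /dot /= !mulr0 addr0.
  move=> s1; have s00 : s = 0 by lra.
  apply: pC; rewrite -(nap_range G); exists b => //.
  by rewrite gb s00 scale0r addr0.
by have := nap_convex G ne; rewrite db; lra.
Qed.

(** Of two points of the oval on one ray from the interior point [p], the farther
    would lie beyond the tangent at the nearer. *)
Lemma radial_unique (a b l : R) : 0 < l -> g b - p = l *: (g a - p) -> g b = g a.
Proof.
have key (a' b' m : R) : 1 < m -> g b' - p = m *: (g a' - p) -> g b' <> g a' -> False.
  move=> m1 e ne.
  have h1 := nap_convex G ne; have h2 := interior_inside a'.
  have eb : g b' - g a' = (m - 1) *: (- 1 *: (p - g a')).
    by rewrite scaleN1r opprB scalerBl scale1r -e opprB addrA subrK.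
  rewrite eb !dotZ in h1; nra.
move=> l0 e; apply: contrapT => ne.
case: (ltgtP l 1) => l1.
- apply: (key b a l^-1) (nesym ne); first by rewrite invf_gt1.
  by rewrite e scalerA mulVf ?scale1r // gt_eqF.
- exact: key l1 e ne.
- by apply: ne; move: e; rewrite l1 scale1r => /addIr.
Qed.

(** The vector from [p] to [g a] turns counterclockwise because the support
    function of the oval about [p] is positive, by [interior_inside]. *)
Lemma radial_lift_exists : exists A B,
  angle_lift (fun a => (g a).1 - p.1) (fun a => (g a).2 - p.2) (pi *+ 2) A B.
Proof.
have C1 : Cinf (fun a => (g a).1 - p.1).
  by apply: CinfB; [exact: nap_Cinf1 G|exact: Cinf_cst].
have C2 : Cinf (fun a => (g a).2 - p.2).
  by apply: CinfB; [exact: nap_Cinf2 G|exact: Cinf_cst].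
apply: angle_lift_exists => //.
- exact: two_pi_gt0.
- move=> a; have [k k0 [e1 e2]] := nap_velocity G a.
  have -> : derive1 (fun a => (g a).1 - p.1) a = - (k * sin a).
    rewrite (is_derive1E (is_derive_sub (Cinf_is_derive (nap_Cinf1 G) a) (is_derive_const _ _))).
    by rewrite e1 subr0.
  have -> : derive1 (fun a => (g a).2 - p.2) a = k * cos a.
    rewrite (is_derive1E (is_derive_sub (Cinf_is_derive (nap_Cinf2 G) a) (is_derive_const _ _))).
    by rewrite e2 subr0.
  have := interior_inside a; rewrite -oppr_gt0 dot_nvecE !coordE => h.
  have := mulr_gt0 k0 h; congr (0 < _); ring.
- by move=> a; rewrite (nap_periodic G).
- by move=> a; rewrite (nap_periodic G).
- move=> a s l /andP[s0 s2] l0 e1 e2.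
  apply: (@nap_inj _ _ _ G a (a + s)); first by rewrite ltrDl s0 ltrD2l.
  by apply: (radial_unique l0); congr (_, _).
Qed.

End interior.
End chords.

(** * Chords through the point and their images *)

Section pencil.
Context {R : realType} (C : oval R) (g : R -> R * R).
Context (G : normal_angle_param C g).
Context (p : R * R) (p_int : oval_int C p) (A psi : R -> R).
Local Notation pi := (@pi R).
(* [psi phi] is the normal angle at the point of polar angle [phi] about [p]. *)
Context (L : angle_lift (fun a => (g a).1 - p.1) (fun a => (g a).2 - p.2)
                        (pi *+ 2) A psi).

Definition polar_point phi := g (psi phi).
Local Notation X := polar_point.

Definition radius phi := dot (nvec phi) (X phi - p).
Local Notation r := radius.

Lemma polar_pointE phi : 0 < r phi /\ X phi - p = r phi *: nvec phi.
Proof.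
have [l l0 [e1 e2]] := lift_direction L (psi phi).
rewrite (lift_invK L) in e1 e2.
have e : X phi - p = l *: nvec phi by apply: plane_ext.
have rl : r phi = l by rewrite /r e dotZ nvec_dot mulr1.
by rewrite rl.
Qed.

Lemma psiD2pi phi : psi (phi + pi *+ 2) = psi phi + pi *+ 2.
Proof. exact: lift_invD L phi. Qed.

Lemma psi_int phi (k : int) : psi (phi + pi *+ 2 * k%:~R) = psi phi + pi *+ 2 * k%:~R.
Proof.
have h x : psi (x + pi *+ 2) - (x + pi *+ 2) = psi x - x by rewrite psiD2pi; ring.
have := periodic_int k phi h; lra.
Qed.

Lemma psi_lt : {mono psi : x y / x < y}. Proof. exact: lift_inv_lt L. Qed.

Lemma psi_bounds phi : psi phi < psi (phi + pi) < psi phi + pi *+ 2.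
Proof.
have p0 := pi_gt0 R.
by rewrite -psiD2pi !psi_lt ltrDl p0 ltrD2l mulr2n ltrDl.
Qed.

Lemma polar_point_int phi (k : int) : X (phi + pi *+ 2 * k%:~R) = X phi.
Proof. by rewrite /X psi_int (periodic_int k _ (nap_periodic G)). Qed.

Lemma polar_point2pi phi : X (phi + pi *+ 2) = X phi.
Proof. by rewrite /X psiD2pi (nap_periodic G). Qed.

Lemma polar_point_onto a : X (A a) = g a.
Proof. by rewrite /X (liftK L). Qed.

Lemma polar_point_neq phi : X phi <> X (phi + pi).
Proof. by apply/nesym/(nap_inj G); exact: psi_bounds. Qed.

Lemma polar_radiusE phi : polar_radius C p phi = r phi.
Proof.
have [r0 e] := polar_pointE phi.
apply: xget_unique.
  split => //; rewrite -(nap_range G); exists (psi phi) => //.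
  by rewrite -e addrC subrK.
move=> s [s0]; rewrite -(nap_range G) => -[b _ gb].
have gX : g b = X phi.
  apply: (radial_unique G p_int (a := psi phi) (b := b) (l := s / r phi)).
    by rewrite divr_gt0.
  by rewrite -[g (psi phi)]/(X phi) e scalerA divfK ?gt_eqF // gb addrC addKr.
by rewrite /r -gX gb [p + _]addrC addrK dotZ nvec_dot mulr1.
Qed.

(** The polar angles of the two ends are equal modulo [pi], and equal modulo
    [2 pi] only if the ends coincide. *)
Lemma chord_through (a b : R) : g a <> g b -> line_through (g a) (g b) p ->
  exists phi, g a = X phi /\ g b = X (phi + pi).
Proof.
move=> ab; rewrite /line_through /= => h.
exists (A a); split; first by rewrite polar_point_onto.
have [r1 e1] := polar_pointE (A a); have [r2 e2] := polar_pointE (A b).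
rewrite !polar_point_onto in e1 e2.
have : r (A a) * r (A b) * sin (A b - A a) = 0.
  rewrite -cross_nvec -mulrA -crossZr -crossZ -e1 -e2 -[RHS]h.
  by rewrite /cross !coordE; ring.
move/eqP; rewrite !mulf_eq0 (gt_eqF r1) (gt_eqF r2) /= => /eqP /sin_eq0_mod[k [e|e]].
  have Ab : A b = A a + pi *+ 2 * k%:~R by lra.
  by case: ab; rewrite -!polar_point_onto Ab polar_point_int.
have Ab : A b = A a + pi + pi *+ 2 * k%:~R by lra.
by rewrite -polar_point_onto Ab polar_point_int.
Qed.

Lemma polar_line phi : line_through (X phi) (X (phi + pi)) = line_normal p (phi + pi / 2) 0.
Proof.
have [r1 e1] := polar_pointE phi; have [r2 e2] := polar_pointE (phi + pi).
rewrite nvecDpi scalerN in e2.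
rewrite (@line_through_normal _ _ _ (phi + pi / 2) (r phi + r (phi + pi))).
- rewrite (line_normal_base p) add0r e1 dotZ nvecDpihalf.
  by rewrite (_ : dot _ _ = 0) ?mulr0 // /dot /=; ring.
- by rewrite gt_eqF // addr_gt0.
rewrite tvecDpihalf scalerN scalerDl opprD -e2 -e1.
by apply: plane_ext; rewrite !coordE; ring.
Qed.

Lemma center_on_polar_line phi : line_through (X phi) (X (phi + pi)) p.
Proof.
by rewrite polar_line /line_normal /= subrr /dot /= !mulr0 addr0.
Qed.

(** By [orientation] the segment from [g c] to [g d] lies strictly on one side of
    the line through [g a] and [g b], and [p] belongs to that segment. *)
Lemma disjoint_chords_through (a b c d : R) : a < b -> b < c -> c < d ->
  d < a + pi *+ 2 -> line_through (g a) (g b) p -> ~ line_through (g c) (g d) p.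
Proof.
move=> ab bc cd da lab lcd.
have gcd : g c <> g d.
  by apply/nesym/(nap_inj G); rewrite cd (lt_trans da) // ltrD2r (lt_trans ab).
have [phi [ec ed]] := chord_through gcd lcd.
have h1 := orientation G ab bc (lt_trans cd da).
have h2 := orientation G ab (lt_trans bc cd) da.
have [r1 e1] := polar_pointE phi; have [r2 e2] := polar_pointE (phi + pi).
rewrite -ec in e1; rewrite -ed nvecDpi in e2.
have : r (phi + pi) * cross (g b - g a) (g c - g a) +
       r phi * cross (g b - g a) (g d - g a) =
       (r phi + r (phi + pi)) * cross (g b - g a) (p - g a).
  have e : r (phi + pi) *: (g c - p) + r phi *: (g d - p) = 0.
    by rewrite e1 e2 scalerN scalerA !scalerN !scalerA mulrC subrr.
  rewrite -[RHS]addr0 -(_ : cross (g b - g a) (r (phi + pi) *: (g c - p) + r phi *: (g d - p)) = 0).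
    by rewrite /cross !coordE; ring.
  by rewrite e /cross /= !mulr0 subrr.
have -> : cross (g b - g a) (p - g a) = 0 by exact: lab.
rewrite mulr0.
by apply/eqP; rewrite gt_eqF // addr_gt0 // mulr_gt0.
Qed.

Definition image_point phi := g (psi phi + pi).
Local Notation Y := image_point.

Lemma image_point_iota phi : iota_oval C (X phi) = Y phi.
Proof. exact: (nap_iota G). Qed.

Lemma image_point2pi phi : Y (phi + pi *+ 2) = Y phi.
Proof. by rewrite /Y psiD2pi addrAC (nap_periodic G). Qed.

Lemma image_point_int phi (k : int) : Y (phi + pi *+ 2 * k%:~R) = Y phi.
Proof. by rewrite /Y psi_int addrAC (periodic_int k _ (nap_periodic G)). Qed.

Definition image_chord phi := Y (phi + pi) - Y phi.
Local Notation D := image_chord.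

Lemma image_chordDpi phi : D (phi + pi) = - D phi.
Proof.
by rewrite /D -addrA -mulr2n image_point2pi opprB.
Qed.

Lemma image_point_neq phi : Y phi <> Y (phi + pi).
Proof.
apply/nesym/(nap_inj G); have /andP[h1 h2] := psi_bounds phi.
by rewrite ltrD2r h1 addrAC ltrD2r.
Qed.

(** The image chords interlace when the chords do, and therefore cross. *)
Lemma cross_image_chords phi s : 0 < s < pi -> 0 < cross (D phi) (D (phi + s)).
Proof.
move=> /andP[s0 sp].
pose a := psi phi + pi; pose b := psi (phi + s) + pi.
pose c := psi (phi + pi) + pi; pose d := psi (phi + s + pi) + pi.
have ab : a < b by rewrite ltrD2r psi_lt ltrDl.
have bc : b < c by rewrite ltrD2r psi_lt ltrD2l.
have cd : c < d by rewrite ltrD2r psi_lt addrAC ltrDl.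
have da : d < a + pi *+ 2.
  by rewrite /a addrAC ltrD2r -psiD2pi psi_lt -addrA ltrD2l mulr2n ltrD2r.
have h1 := orientation G ab bc (lt_trans cd da).
have h2 := orientation G (lt_trans ab bc) cd da.
have := addr_gt0 h1 h2; rewrite /D -/(Y phi) -/(Y (phi + s)).
rewrite -[Y phi]/(g a) -[Y (phi + s)]/(g b) -[Y (phi + pi)]/(g c) -[Y (phi + s + pi)]/(g d).
by congr (0 < _); rewrite /cross !coordE; ring.
Qed.

Lemma Cinf_polar : Cinf (fun t => (X t).1) /\ Cinf (fun t => (X t).2).
Proof.
have Cpsi := lift_inv_Cinf L.
split; first exact: (Cinf_comp (nap_Cinf1 G) Cpsi).
exact: (Cinf_comp (nap_Cinf2 G) Cpsi).
Qed.

Lemma Cinf_image : Cinf (fun t => (Y t).1) /\ Cinf (fun t => (Y t).2).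
Proof.
have Cpsi : Cinf (fun t => psi t + pi).
  by apply: CinfD; [exact: lift_inv_Cinf L|exact: Cinf_cst].
split; first exact: (Cinf_comp (nap_Cinf1 G) Cpsi).
exact: (Cinf_comp (nap_Cinf2 G) Cpsi).
Qed.

Lemma image_velocity phi : exists2 k, 0 < k &
  derive1 (fun t => (Y t).1) phi = - (k * sin (psi phi + pi)) /\
  derive1 (fun t => (Y t).2) phi = k * cos (psi phi + pi).
Proof.
have [k k0 [e1 e2]] := nap_velocity G (psi phi + pi).
have d := is_derive_add (Cinf_is_derive (lift_inv_Cinf L) phi) (is_derive_const pi phi).
rewrite addr0 in d.
exists (k * derive1 psi phi); first by rewrite mulr_gt0 // (lift_inv_derive_gt0 L).
split.
  rewrite (is_derive1E (@is_derive_chain _ (fun a => (g a).1) (fun y => psi y + pi) _ _ _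
    (Cinf_is_derive (nap_Cinf1 G) _) d)).
  by rewrite e1; ring.
rewrite (is_derive1E (@is_derive_chain _ (fun a => (g a).2) (fun y => psi y + pi) _ _ _
    (Cinf_is_derive (nap_Cinf2 G) _) d)).
by rewrite e2; ring.
Qed.

(** The vector that is lifted is the normal of the image chord. Both ends of the
    chord move forward along a convex curve, so it turns counterclockwise; and
    [cross_image_chords] forbids equal directions within a period. *)
Lemma image_lift_exists : exists Th Ps,
  angle_lift (fun t => (D t).2) (fun t => - (D t).1) (pi *+ 2) Th Ps.
Proof.
have [CY1 CY2] := Cinf_image.
have C1 : Cinf (fun t => (D t).2).
  by apply: (@CinfB _ (fun t => (Y (t + pi)).2)) => //; exact: Cinf_shift CY2.
have C2' : Cinf (fun t => (D t).1).
  by apply: (@CinfB _ (fun t => (Y (t + pi)).1)) => //; exact: Cinf_shift CY1.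
have C2 := CinfN C2'.
have D2pi t : D (t + pi *+ 2) = D t by rewrite mulr2n addrA !image_chordDpi opprK.
apply: angle_lift_exists => //.
- exact: two_pi_gt0.
- move=> t.
  have [k k0 [e1 e2]] := image_velocity t.
  have [m m0 [f1 f2]] := image_velocity (t + pi).
  have d1 : derive1 (fun t => - (D t).1) t =
      - (- (m * sin (psi (t + pi) + pi)) + k * sin (psi t + pi)).
    have := is_derive_opp (is_derive_sub
      (is_derive_translate (Cinf_is_derive CY1 (t + pi))) (Cinf_is_derive CY1 t)).
    by move=> /is_derive1E ->; rewrite e1 f1 opprK.
  have d2 : derive1 (fun t => (D t).2) t = m * cos (psi (t + pi) + pi) - k * cos (psi t + pi).
    have := is_derive_sub
      (is_derive_translate (Cinf_is_derive CY2 (t + pi))) (Cinf_is_derive CY2 t).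
    by move=> /is_derive1E ->; rewrite e2 f2.
  rewrite d1 d2.
  have h1 := nap_convex G (nesym (@image_point_neq t)).
  have h2 := nap_convex G (@image_point_neq t).
  rewrite -/(D t) in h1.
  have {}h2 : 0 < dot (nvec (psi (t + pi) + pi)) (D t).
    by rewrite -oppr_lt0 -dotN /D opprB.
  have h3 : 0 < m * dot (nvec (psi (t + pi) + pi)) (D t) - k * dot (nvec (psi t + pi)) (D t).
    by rewrite subr_gt0 (lt_trans (y := 0)) ?pmulr_rlt0 ?pmulr_rgt0.
  by move: h3; rewrite /dot /nvec /=; congr (0 < _); ring.
- by move=> t; rewrite D2pi.
- by move=> t; rewrite D2pi.
- move=> t s l /andP[s0 s2] l0 e1 /eqP; rewrite mulrN eqr_opp => /eqP e2.
  have e : D (t + s) = l *: D t by apply: plane_ext.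
  have Dn0 : D t <> 0.
    by move=> /eqP; rewrite subr_eq0 => /eqP/esym; exact: image_point_neq.
  have cr (k : R) : cross (D t) (k *: D t) = 0 by rewrite crossZr /cross; ring.
  case: (ltgtP s pi) => sp.
  + by have := @cross_image_chords t s; rewrite s0 sp e cr ltxx => /(_ isT).
  + have := @cross_image_chords t (s - pi).
    have -> : D (t + (s - pi)) = - l *: D t.
      apply: oppr_inj; rewrite -image_chordDpi -addrA subrK e.
      by rewrite scaleNr opprK.
    rewrite cr ltxx subr_gt0 sp ltrBlDr -mulr2n s2 => /(_ isT) //.
  + move: e; rewrite sp image_chordDpi => /eqP; rewrite eq_sym -subr_eq0 opprK.
    rewrite -[X in _ + X]scale1r -scalerDl scaler_eq0 gt_eqF ?addr_gt0 //=.
    by move/eqP.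
Qed.

End pencil.

(** * The support function of the image lines *)

Section support.
Context {R : realType} (C : oval R) (g : R -> R * R).
Context (G : normal_angle_param C g).
Context (p : R * R) (p_int : oval_int C p) (A psi : R -> R).
Local Notation pi := (@pi R).
Context (L : angle_lift (fun a => (g a).1 - p.1) (fun a => (g a).2 - p.2)
                        (pi *+ 2) A psi).
Local Notation X := (polar_point g psi).
Local Notation Y := (image_point g psi).
Local Notation D := (image_chord g psi).
Local Notation r := (radius g p psi).
Context (Th Ps : R -> R).
(* [Th phi] is the normal angle of the image of the line of direction [phi]. *)
Context (LD : angle_lift (fun t => (D t).2) (fun t => - (D t).1) (pi *+ 2) Th Ps).

Lemma image_chordE t : exists2 l, 0 < l & D t = l *: tvec (Th t).
Proof.
have [l l0 [e1 e2]] := lift_direction LD t; exists l => //.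
apply: plane_ext; last exact: e1.
by rewrite !coordE /tvec /= mulrN -e2 opprK.
Qed.

(** The shift by [pi] reverses the image chord, and the angle increases by less
    than [2 pi]. *)
Lemma image_angleDpi t : Th (t + pi) = Th t + pi.
Proof.
have p0 := pi_gt0 R.
have h1 : Th t < Th (t + pi) by rewrite (lift_lt LD) ltrDl.
have h2 : Th (t + pi) < Th t + pi *+ 2.
  by rewrite -(liftD LD) (lift_lt LD) ltrD2l mulr2n ltrDl.
have [l l0 e] := image_chordE t; have [m m0 f] := image_chordE (t + pi).
have : m * sin (Th t - Th (t + pi)) = 0.
  rewrite -dot_nvec_tvec -dotZ -f (image_chordDpi G L) e dotN dotZ.
  by rewrite dot_nvec_tvec subrr sin0 mulr0 oppr0.
move/eqP; rewrite mulf_eq0 gt_eqF //= => /eqP s0.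
have [||d0|] := @sin_eq0_in _ (Th (t + pi) - Th t); last by lra.
- by apply/andP; split; lra.
- by rewrite -opprB sinN s0 oppr0.
- by move: d0 h1; lra.
Qed.

Lemma image_angle_invDpi t : Ps (t + pi) = Ps t + pi.
Proof. by apply: (can_inj (liftK LD)); rewrite image_angleDpi !(lift_invK LD). Qed.

Lemma image_angle_inv_int t (k : int) : Ps (t + pi *+ 2 * k%:~R) = Ps t + pi *+ 2 * k%:~R.
Proof.
have h x : Ps (x + pi *+ 2) - (x + pi *+ 2) = Ps x - x by rewrite (lift_invD LD); ring.
have := periodic_int k t h; lra.
Qed.

Definition support t := dot (nvec t) (Y (Ps t) - p).
Local Notation q := support.

Lemma image_line t :
  line_through (Y (Ps t)) (Y (Ps t + pi)) = line_normal p t (q t).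
Proof.
have [l l0 e] := image_chordE (Ps t); rewrite (lift_invK LD) in e.
by rewrite (line_through_normal (lt0r_neq0 l0) e) (line_normal_base p) add0r.
Qed.

Lemma support_opposite t : dot (nvec t) (Y (Ps t + pi) - p) = q t.
Proof.
have : line_normal p t (q t) (Y (Ps t + pi)).
  by rewrite -image_line; exact: line_through_right.
by [].
Qed.

Lemma support_antiperiodic : antiperiodic q.
Proof.
move=> t; rewrite -(support_opposite t) /support image_angle_invDpi nvecDpi.
by rewrite /dot !coordE; ring.
Qed.

Lemma Cinf_support : Cinf q.
Proof.
have [C1 C2] := Cinf_image G L.
have CP := lift_inv_Cinf LD.
have D1 : Cinf (fun t => (Y (Ps t)).1 - p.1).
  by apply: CinfB; [exact: (Cinf_comp C1 CP)|exact: Cinf_cst].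
have D2 : Cinf (fun t => (Y (Ps t)).2 - p.2).
  by apply: CinfB; [exact: (Cinf_comp C2 CP)|exact: Cinf_cst].
by apply: CinfD; apply: CinfM => //; have [? ?] := @Cinf_cos_sin R.
Qed.

Lemma Phi_pencilP L' : Phi_pencil C p L' <->
  exists phi, L' = line_through (Y phi) (Y (phi + pi)).
Proof.
split.
  case=> L0 [_ L0p] [x [y [+ + xy L0E L'E]]]; rewrite -!(nap_range G).
  move=> [a _ ax] [b _ bY]; subst x y.
  have [phi [ea eb]] := chord_through G L xy (eq_ind _ (fun S : set _ => S p) L0p _ L0E).
  by exists phi; rewrite L'E ea eb !(image_point_iota G).
move=> [phi L'E]; exists (line_through (X phi) (X (phi + pi))).
  split; last exact: center_on_polar_line L phi.
  by exists (X phi), (X (phi + pi)); split => //; exact: (polar_point_neq G L).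
exists (X phi), (X (phi + pi)); split => //.
- by rewrite -(nap_range G); exists (psi phi).
- by rewrite -(nap_range G); exists (psi (phi + pi)).
- exact: (polar_point_neq G L).
- by rewrite L'E !(image_point_iota G).
Qed.

(** The image chords with normal [nvec t] up to sign are those at [Ps t] and
    [Ps t + pi], which carry the same line. *)
Lemma Phi_pencil_support t c : Phi_pencil C p (line_normal p t c) <-> c = q t.
Proof.
rewrite Phi_pencilP; split; last by move=> ->; exists (Ps t); rewrite image_line.
case=> phi e.
have h1 : dot (nvec t) (Y phi - p) = c.
  have : line_normal p t c (Y phi) by rewrite e; exact: line_through_left.
  by [].
have h2 : dot (nvec t) (Y (phi + pi) - p) = c.
  have : line_normal p t c (Y (phi + pi)) by rewrite e; exact: line_through_right.
  by [].
have [l l0 el] := image_chordE phi.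
have : l * sin (t - Th phi) = 0.
  rewrite -dot_nvec_tvec -dotZ -el.
  have -> : D phi = (Y (phi + pi) - p) - (Y phi - p).
    by apply: plane_ext; rewrite !coordE; ring.
  by rewrite dotD dotN h1 h2 subrr.
move/eqP; rewrite mulf_eq0 gt_eqF //= => /eqP /sin_eq0_mod[k [tE|tE]].
  have -> : t = Th phi + pi *+ 2 * k%:~R by lra.
  have tE' : t = Th phi + pi *+ 2 * k%:~R by lra.
  by rewrite /q -tE' -[in Y _](_ : phi + pi *+ 2 * k%:~R = Ps t) ?(image_point_int G L) //
    tE' image_angle_inv_int (liftK LD).
have tE' : t = Th (phi + pi) + pi *+ 2 * k%:~R by rewrite image_angleDpi; lra.
have -> : q t = dot (nvec t) (Y (Ps t) - p) by [].
have -> : Ps t = phi + pi + pi *+ 2 * k%:~R.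
  by rewrite tE' image_angle_inv_int (liftK LD).
by rewrite (image_point_int G L).
Qed.

Lemma ART_supportE : ART_support C p = q.
Proof.
apply/funext => t; apply: xget_unique; first exact/Phi_pencil_support.
by move=> c /Phi_pencil_support.
Qed.

(** An affine chord through [p] is its own image, and the normal of this line is
    perpendicular to [nvec phi]. *)
Lemma self_image_chord phi : psi (phi + pi) = psi phi + pi -> q (phi + pi / 2) = 0.
Proof.
move=> e; apply/esym/Phi_pencil_support/Phi_pencilP.
exists phi; rewrite -(polar_line L) line_throughC.
have -> : X (phi + pi) = Y phi by rewrite /polar_point e.
have -> // : X phi = Y (phi + pi).
by rewrite /image_point e -addrA -mulr2n (nap_periodic G).
Qed.

(** If the ends [g a], [g b] of the chord were not exchanged by [iota_oval], then
    [a], [b], [a + pi], [b + pi], or [b], [a], [b + pi], [a + pi], would be in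
    cyclic order, so that the chord and its image, both through [p], would be
    disjoint. *)
Lemma support_zero_affine t : q t = 0 ->
  psi (Ps t + pi) = psi (Ps t) + pi.
Proof.
move=> qt; set phi := Ps t.
pose a := psi phi; pose b := psi (phi + pi).
have /andP[ab ba] : a < b < a + pi *+ 2 by exact: (psi_bounds L).
have lab : line_through (g a) (g b) p by exact: (center_on_polar_line L phi).
have lcd : line_through (g (a + pi)) (g (b + pi)) p.
  have : line_normal p t (q t) p by rewrite qt /line_normal /= subrr /dot /= !mulr0 addr0.
  by rewrite -image_line.
have p0 := pi_gt0 R.
rewrite -/a -/b; case: (ltgtP b (a + pi)) => // h; exfalso.
  apply: (disjoint_chords_through G L ab h _ _ lab lcd).
    by rewrite ltrD2r.
  by rewrite two_piE (addrA a) ltrD2r.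
apply: (disjoint_chords_through G L ba _ _ _ _ (c := b + pi) (d := a + pi *+ 2 + pi)).
- by rewrite two_piE (addrA a) ltrD2r.
- by rewrite ltrD2r.
- by rewrite addrAC ltrD2r.
- by rewrite (nap_periodic G) line_throughC.
- by rewrite addrAC (nap_periodic G) line_throughC.
Qed.

(** The bijection sends a zero [t] of [q] to the line through [p] with normal
    [nvec t]. *)
Lemma affine_chords_card (n : nat) : mod_pi (zero_set q) #= `I_n ->
  affine_chords_at C p #= `I_n.
Proof.
move=> qn.
have inj : {in mod_pi (zero_set q) &, injective (fun t => line_normal p t 0)}.
  move=> s t; rewrite !inE => -[hs _] [ht _] /line_normal_eq.
  exact: sin_sub_eq0_inj.
rewrite -(card_eqr qn) -(card_eqr (inj_card_eq inj)).
suff -> : affine_chords_at C p = (fun t => line_normal p t 0) @` mod_pi (zero_set q).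
  exact: card_eqxx.
apply/seteqP; split => [L' [[x]]|_ [t [_ qt] <-]]; last first.
  have e := support_zero_affine qt.
  have LE := image_line t; rewrite qt in LE; split; last first.
    by rewrite /line_normal /= subrr /dot /= !mulr0 addr0.
  exists (Y (Ps t)); first by rewrite -(nap_range G); exists (psi (Ps t) + pi).
  rewrite -LE; congr line_through.
  by rewrite (nap_iota G) /image_point e.
rewrite -(nap_range G) => -[a _ <-] -> ; rewrite (nap_iota G) => lp.
have p0 := pi_gt0 R.
have ne : g a <> g (a + pi).
  by apply/nesym/(nap_inj G); rewrite ltrDl p0 ltrD2l mulr2n ltrDl.
have [phi [e1 e2]] := chord_through G L ne lp.
have LE : line_through (g a) (g (a + pi)) = line_normal p (phi + pi / 2) 0.
  by rewrite e1 e2 (polar_line L).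
have [k hk] := reduce_modulo (phi + pi / 2) (pi_gt0 R).
have LE' : line_normal p (phi + pi / 2) 0 = line_normal p (phi + pi / 2 + pi * k%:~R) 0.
  apply/esym; apply: (periodic_int (f := fun t => line_normal p t 0)) => t.
  by rewrite line_normalDpi oppr0.
exists (phi + pi / 2 + pi * k%:~R); last by rewrite -LE' -LE.
split=> //; apply/esym/Phi_pencil_support; rewrite -LE' -LE.
exists (line_through (g a) (g (a + pi))).
  by split => //; exists (g a), (g (a + pi)).
exists (g a), (g (a + pi)); split => //.
- by rewrite -(nap_range G); exists a.
- by rewrite -(nap_range G); exists (a + pi).
rewrite !(nap_iota G) line_throughC -addrA -mulr2n.
by rewrite (nap_periodic G).
Qed.

Lemma Cinf_radius : Cinf r.
Proof.
have [C1 C2] := Cinf_polar G L.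
by apply: CinfD; apply: CinfM; try (by have [? ?] := @Cinf_cos_sin R);
  apply: CinfB => //; exact: Cinf_cst.
Qed.

(** [(r', r)] are the coordinates of the velocity in the frame of [nvec phi] and
    [tvec phi], and this velocity has direction [tvec (psi phi)]. *)
Lemma radius_tangent phi : exists2 m, 0 < m &
  r phi = m * cos (psi phi - phi) /\ derive1 r phi = - (m * sin (psi phi - phi)).
Proof.
have [C1 C2] := Cinf_polar G L.
have [k k0 [e1 e2]] := nap_velocity G (psi phi).
have dpsi := Cinf_is_derive (lift_inv_Cinf L) phi.
have d1 : is_derive phi 1 (fun t => (X t).1) (- (k * sin (psi phi)) * derive1 psi phi).
  by rewrite -e1; exact: is_derive_chain (Cinf_is_derive (nap_Cinf1 G) (psi phi)) dpsi.
have d2 : is_derive phi 1 (fun t => (X t).2) ((k * cos (psi phi)) * derive1 psi phi).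
  by rewrite -e2; exact: is_derive_chain (Cinf_is_derive (nap_Cinf2 G) (psi phi)) dpsi.
have d1p := is_derive_sub d1 (is_derive_const p.1 phi).
have d2p := is_derive_sub d2 (is_derive_const p.2 phi).
rewrite !subr0 in d1p d2p.
pose m := k * derive1 psi phi.
have m0 : 0 < m by rewrite mulr_gt0 // (lift_inv_derive_gt0 L).
have [r0 re] := polar_pointE L phi.
have f1 : (X phi).1 - p.1 = r phi * cos phi by have := congr1 fst re.
have f2 : (X phi).2 - p.2 = r phi * sin phi by have := congr1 snd re.
have cs := cos2Dsin2 phi.
exists m => //; split; last first.
  have dr := is_derive_add (is_derive_mul (is_derive_cos phi) d1p)
                           (is_derive_mul (is_derive_sin phi) d2p).
  rewrite (_ : derive1 r phi = derive1 (fun y =>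
    cos y * ((X y).1 - p.1) + sin y * ((X y).2 - p.2)) phi) //.
  rewrite (is_derive1E dr) f1 f2 sinB /m; ring.
(* The other equation comes from differentiating [cross (nvec t) (X t - p) = 0]. *)
pose F t := cos t * ((X t).2 - p.2) - sin t * ((X t).1 - p.1).
have F0 : F = fun=> 0.
  apply/funext => t; have [_ te] := polar_pointE L t.
  have -> : F t = cross (nvec t) (X t - p) by [].
  by rewrite te crossZr cross_nvec subrr sin0 mulr0.
have dF := is_derive_sub (is_derive_mul (is_derive_cos phi) d2p)
                         (is_derive_mul (is_derive_sin phi) d1p).
have := is_derive1E dF.
rewrite -[derive1 _ _]/(derive1 F phi) F0 (is_derive1E (is_derive_const 0 phi)).
rewrite f1 f2 => e.
rewrite cosB /m -[LHS]mulr1 -cs; apply/eqP; rewrite -subr_eq0 -[X in _ == X]oppr0 e.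
by apply/eqP; ring.
Qed.

Lemma log_ratioE : log_ratio C p = fun phi => ln (r (phi + pi)) - ln (r phi).
Proof.
apply/funext => phi; rewrite /log_ratio !(polar_radiusE G p_int L).
have [r0 _] := polar_pointE L phi; have [r1 _] := polar_pointE L (phi + pi).
by rewrite ln_div.
Qed.

Lemma radiusD2pi phi : r (phi + pi *+ 2) = r phi.
Proof. by rewrite /radius (polar_point2pi G L) mulr2n addrA !nvecDpi opprK. Qed.

Lemma log_ratio_antiperiodic : antiperiodic (log_ratio C p).
Proof.
by move=> phi; rewrite log_ratioE -addrA -mulr2n radiusD2pi opprB.
Qed.

Lemma is_derive_log_ratio (phi : R) : is_derive phi 1 (log_ratio C p)
  (derive1 r (phi + pi) / r (phi + pi) - derive1 r phi / r phi : R).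
Proof.
have dln (t : R) : is_derive t 1 (fun t : R => ln (r t)) (derive1 r t / r t : R).
  have [r0 _] := polar_pointE L t.
  have := is_derive_chain (is_derive1_ln r0) (Cinf_is_derive Cinf_radius t).
  by rewrite mulrC.
rewrite log_ratioE.
exact: is_derive_sub (is_derive_translate (dln (phi + pi))) (dln phi).
Qed.

Lemma Cinf_log_ratio : Cinf (log_ratio C p).
Proof.
apply: Cinf_primitive is_derive_log_ratio _.
have Cr := Cinf_radius.
have Cq : Cinf (fun t => derive1 r t / r t).
  apply: CinfM; first exact: Cinf_derive1.
  by apply: CinfV => // t; have [r0 _] := polar_pointE L t; rewrite gt_eqF.
by apply: CinfB => //; exact: Cinf_shift Cq.
Qed.

(** Equal logarithmic derivatives of the radius at opposite points mean equal
    angles between tangent and chord, hence parallel tangents. *)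
Lemma log_ratio_critical phi : derive1 (log_ratio C p) phi = 0 ->
  q (phi + pi / 2) = 0.
Proof.
rewrite (is_derive1E (is_derive_log_ratio phi)) => /eqP; rewrite subr_eq0.
have [r0 _] := polar_pointE L phi; have [r1 _] := polar_pointE L (phi + pi).
rewrite eqr_div ?lt0r_neq0 // => /eqP.
have [m m0 [-> ->]] := radius_tangent phi.
have [k k0 [-> ->]] := radius_tangent (phi + pi).
set d := psi phi - phi; set e := psi (phi + pi) - _ => h.
have : m * k * sin (d - e) = 0.
  rewrite sinB -(subr0 (m * k * _)) -(subrr (- (k * sin e) * (m * cos d))) {2}h.
  by ring.
move/eqP; rewrite mulf_eq0 gt_eqF ?mulr_gt0 //= => /eqP s0.
apply: self_image_chord.
have /andP[h1 h2] := psi_bounds L phi.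
have [||d0|] := @sin_eq0_in _ (psi (phi + pi) - psi phi).
- by apply/andP; split; lra.
- have -> : psi (phi + pi) - psi phi = - (d - e) + pi by rewrite /d /e; ring.
  by rewrite sinDpi sinN s0 !oppr0.
- by move: d0 h1; lra.
- by lra.
Qed.

End support.

(** * Cusps, affine chords and centred chords *)

Section conclusion.
Context {R : realType} (C : oval R) (g : R -> R * R).
Context (G : normal_angle_param C g).
Context (p : R * R) (p_int : oval_int C p) (A psi : R -> R).
Local Notation pi := (@pi R).
Context (L : angle_lift (fun a => (g a).1 - p.1) (fun a => (g a).2 - p.2)
                        (pi *+ 2) A psi).
Local Notation X := (polar_point g psi).
Local Notation D := (image_chord g psi).
Local Notation r := (radius g p psi).
Context (Th Ps : R -> R).
Context (LD : angle_lift (fun t => (D t).2) (fun t => - (D t).1) (pi *+ 2) Th Ps).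
Local Notation q := (support g p psi Ps).

Lemma log_ratio_eq0 phi : log_ratio C p phi = 0 <-> r (phi + pi) = r phi.
Proof.
have [r0 _] := polar_pointE L phi; have [r1 _] := polar_pointE L (phi + pi).
rewrite (log_ratioE G p_int L); split=> [/eqP|->]; last by rewrite subrr.
by rewrite subr_eq0 => /eqP; apply: ln_inj; rewrite posrE.
Qed.

Lemma midpoint_polar phi : midpoint (X phi) (X (phi + pi)) = p <->
  r (phi + pi) = r phi.
Proof.
have [r0 e0] := polar_pointE L phi; have [r1 e1] := polar_pointE L (phi + pi).
rewrite nvecDpi scalerN in e1.
have e : midpoint (X phi) (X (phi + pi)) - p = 2^-1 * (r phi - r (phi + pi)) *: nvec phi.
  have -> : midpoint (X phi) (X (phi + pi)) - p =
      2^-1 *: ((X phi - p) + (X (phi + pi) - p)).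
    by apply: plane_ext; rewrite /midpoint !coordE; field.
  by rewrite e0 e1 -scalerBl scalerA.
split=> [h|h].
  move: e; rewrite h subrr => /(congr1 (dot (nvec phi))).
  rewrite dotZ nvec_dot mulr1 {1}/dot /= !mulr0 addr0 => /esym/eqP.
  by rewrite mulf_eq0 invr_eq0 pnatr_eq0 /= subr_eq0 => /eqP.
by apply/eqP; rewrite -subr_eq0 e h subrr mulr0 scale0r.
Qed.

(** The bijection sends [phi] to the ends of the chord of direction [phi]. *)
Lemma centred_chords_card (n : nat) : mod_pi (zero_set (log_ratio C p)) #= `I_n ->
  centred_chords C p #= `I_n.
Proof.
move=> an; pose S phi := [set X phi; X (phi + pi)].
have inj : {in mod_pi (zero_set (log_ratio C p)) &, injective S}.
  move=> s t; rewrite !inE => -[hs _] [ht _] st.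
  have sX : S t (X s) by rewrite -st; left.
  have [_ e1] := polar_pointE L s; have [r0 e2] := polar_pointE L t.
  have [r0' e3] := polar_pointE L (t + pi).
  have [rs _] := polar_pointE L s.
  apply: sin_sub_eq0_inj hs ht _.
  have cr : cross (nvec s) (X s - p) = 0.
    by rewrite e1 crossZr cross_nvec subrr sin0 mulr0.
  case: sX => sX; move: cr; rewrite sX ?e2 ?e3 crossZr cross_nvec => /eqP.
    by rewrite mulf_eq0 gt_eqF //= => /eqP.
  by rewrite mulf_eq0 gt_eqF //= addrAC sinDpi oppr_eq0 => /eqP.
rewrite -(card_eqr an) -(card_eqr (inj_card_eq inj)).
suff -> : centred_chords C p = S @` mod_pi (zero_set (log_ratio C p)).
  exact: card_eqxx.
apply/seteqP; split => [c [x [y [xC yC xy -> xyp]]]|_ [phi [_ aphi] <-]]; last first.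
  exists (X phi), (X (phi + pi)); split => //.
  - by rewrite -(nap_range G); exists (psi phi).
  - by rewrite -(nap_range G); exists (psi (phi + pi)).
  - exact: (polar_point_neq G L).
  - exact/midpoint_polar/log_ratio_eq0.
move: xC yC; rewrite -!(nap_range G) => -[a _ ax] [b _ bY]; subst x y.
have lp : line_through (g a) (g b) p.
  by rewrite /line_through /= -xyp /midpoint /cross !coordE; field.
have [phi [ea eb]] := chord_through G L xy lp.
rewrite ea eb in xyp *.
have a0 : zero_set (log_ratio C p) phi by exact/log_ratio_eq0/midpoint_polar.
have [k hk] := reduce_modulo phi (pi_gt0 R).
have SS t : S (t + pi) = S t.
  by rewrite /S -addrA -two_piE (polar_point2pi G L) setUC.
exists (phi + pi * k%:~R); last exact: (periodic_int k phi SS).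
split=> //; apply/pi_periodic_int => //.
exact/zero_set_periodic/(log_ratio_antiperiodic G p_int L).
Qed.

Lemma ART_rhoE : ART_rho C p = radius_fun q.
Proof. by rewrite /ART_rho (ART_supportE G L LD). Qed.

Lemma ART_velocity_eq0 t : radius_fun q t = 0 -> velocity (ART C p) t = 0.
Proof.
move=> qt; have Cq := Cinf_support G L LD.
have dq := Cinf_is_derive Cq t.
have dq' := Cinf_is_derive (Cinf_derive1 Cq) t.
have d1 := is_derive_add (is_derive_add (is_derive_const p.1 t)
  (is_derive_mul dq (is_derive_cos t)))
  (is_derive_mul dq' (is_derive_opp (is_derive_sin t))).
have d2 := is_derive_add (is_derive_add (is_derive_const p.2 t)
  (is_derive_mul dq (is_derive_sin t)))
  (is_derive_mul dq' (is_derive_cos t)).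
have e1 := is_derive1E d1; have e2 := is_derive1E d2.
rewrite /velocity /ART (ART_supportE G L LD).
apply: plane_ext => /=.
  apply: etrans e1 _.
  transitivity (- (radius_fun q t * sin t)); first by rewrite /radius_fun; ring.
  by rewrite qt mul0r oppr0.
apply: etrans e2 _.
transitivity (radius_fun q t * cos t); first by rewrite /radius_fun; ring.
by rewrite qt mul0r.
Qed.

Lemma ART_cuspsE : ART_only_ordinary_cusps C p ->
  simple_zeros (radius_fun q) /\ ART_cusps C p = mod_pi (zero_set (radius_fun q)).
Proof.
move=> H.
have sz : simple_zeros (radius_fun q).
  by move=> t /ART_velocity_eq0/H; rewrite /ART_ordinary_cusp ART_rhoE.
split=> //; rewrite /ART_cusps /ART_ordinary_cusp ART_rhoE.
apply/seteqP; split=> t [ht h]; split => //.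
  by case: h.
exact: sz.
Qed.

Lemma cusp_bound : generic_basepoint C p ->
  exists N T M : nat, [/\ ART_cusps C p #= `I_N, affine_chords_at C p #= `I_T,
    centred_chords C p #= `I_M, (3 <= N)%N & (M <= T)%N /\ (T <= maxn 1 N)%N].
Proof.
case=> sa _ sq so.
have Cq := Cinf_support G L LD; have aq := support_antiperiodic G L LD.
have Ca := Cinf_log_ratio G p_int L; have aa := log_ratio_antiperiodic G p_int L.
rewrite (ART_supportE G L LD) in sq.
have [sr cE] := ART_cuspsE so.
have [N HN] := zeros_mod_pi_finite (Cinf_continuous (Cinf_radius_fun Cq)) sr.
have [T HT] := zeros_mod_pi_finite (Cinf_continuous Cq) sq.
have [M HM] := zeros_mod_pi_finite (Cinf_continuous Ca) sa.
exists N, T, M; split.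
- by rewrite cE.
- exact: (affine_chords_card G L LD HT).
- exact: centred_chords_card.
- exact: three_le_zeros_radius_fun HN.
split.
  apply: (rolle_mod_pi (c := pi / 2) Ca aa (zero_set_periodic aq) HM HT).
  exact: (log_ratio_critical G p_int L LD).
rewrite leq_max; case: (leqP T 1) => //= T1.
exact: zeros_le_zeros_radius_fun HT HN.
Qed.

End conclusion.

Theorem theorem4p3 (R : realType) (C : oval R) (p : R * R)
    (p_int : oval_int C p) (p_generic : generic_basepoint C p) :
  exists cusps T M : nat,
    [/\ ART_cusps C p #= `I_cusps,
        affine_chords_at C p #= `I_T,
        centred_chords C p #= `I_M,
        (maxn 3 T <= cusps)%N /\ (maxn 3 M <= maxn 3 T)%N &
        forall (U : set (R * R)) (r : nat),
          wigner_chamber C U -> U p -> M = (2 * r + 1)%N ->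
          (2 * r + 1 <= cusps)%N].
Proof.
have [g G] := normal_angle_param_exists C.
have [A [psi L]] := radial_lift_exists G p_int.
have [Th [Ps LD]] := image_lift_exists G L.
have [N [T [M [HN HT HM N3 [MT TN]]]]] := cusp_bound G p_int L LD p_generic.
exists N, T, M; split => //; first by split; lia.
by move=> U r _ _ <-; lia.
Qed.
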